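(* Let $\Phi\in\mathcal{G}_0$ and suppose the composition-differentiation operator $D_\Phi f=f'\circ\Phi$ is bounded on $\mathcal{H}^2$. Then for every $\delta>0$ there is a constant $C=C(\delta)$ such that $$\frac{M_\Phi(w)}{(\Re(w)-\frac12)^3}<C$$ for every $w\in\mathbb{C}_{1/2}$ not lying in the open disk $\mathbb{D}(\Phi(+\infty),\delta)$ of center $\Phi(+\infty)$ and radius $\delta$. In particular, if $D_\Phi$ is compact on $\mathcal{H}^2$, then $\lim_{\Re(w)\to\frac12^+}M_\Phi(w)/(\Re(w)-\frac12)^3=0$.
   Context: $\mathbb{C}_\theta=\{s:\Re s>\theta\}$. $\mathcal{H}^2$ is the Hilbert space of Dirichlet series $f(s)=\sum_{n\ge1}a_nn^{-s}$ with $\|f\|_{\mathcal{H}^2}^2=\sum_n|a_n|^2<\infty$. $\mathcal{G}_0$ is the class of maps $\Phi(s)=\sum_{n\ge1}c_nn^{-s}$ where the series converges uniformly in $\mathbb{C}_\epsilon$ for every $\epsilon>0$ and $\Phi(\mathbb{C}_0)\subset\mathbb{C}_{1/2}$; $\Phi(+\infty)=c_1$. For $w\in\mathbb{C}_{1/2}$, $w\neq\Phi(+\infty)$, the mean counting function is $$M_\Phi(w)=\lim_{\sigma\to0^+}\lim_{T\to\infty}\frac{\pi}{T}\sum_{\substack{s\in\Phi^{-1}(\{w\})\\ |\Im s|<T,\ \sigma<\Re s<\infty}}\Re(s).$$ *)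

(* Defs.v *)
From HB Require Import structures.
From mathcomp Require Import all_boot all_order all_algebra.
From mathcomp Require Import complex.
From mathcomp Require Import all_classical all_reals all_analysis.
Set Implicit Arguments. Unset Strict Implicit. Unset Printing Implicit Defensive.
Import Order.TTheory GRing.Theory Num.Theory.
Import numFieldNormedType.Exports.
Local Open Scope ring_scope.
Local Open Scope complex_scope.
Local Open Scope classical_set_scope.

Section Dirichlet.
Variable R : realType.
Local Notation C := R[i].

Definition cabs (z : C) : R := Num.sqrt (complex.Re z ^+ 2 + complex.Im z ^+ 2).

(* m^{-s} for a positive integer m and s = x + iy :
   m^{-x} (cos (y ln m) - i sin (y ln m)) *)
Definition npow (m : nat) (s : C) : C :=
  (expR (- complex.Re s * ln m%:R) * cos (complex.Im s * ln m%:R))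
    +i* (- (expR (- complex.Re s * ln m%:R) * sin (complex.Im s * ln m%:R))).

(* CONVENTION: a coefficient sequence a : nat -> C encodes the Dirichlet series
   sum_{n >= 1} a_n n^{-s} via a_n = a (n - 1), i.e. term number k is
   a k * (k+1)^{-s}.  In particular Phi(+oo) = c_1 = c 0. *)
Definition dterm (a : nat -> C) (s : C) (k : nat) : C := a k * npow k.+1 s.

Definition dterm_deriv (a : nat -> C) (s : C) (k : nat) : C :=
  - (a k * (ln (k.+1)%:R)%:C) * npow k.+1 s.

Definition dpart (a : nat -> C) (s : C) (N : nat) : C := \sum_(k < N) dterm a s k.

Definition csum_to (u : nat -> C) (z : C) : Prop :=
  forall e : R, 0 < e -> exists N : nat, forall M : nat, (N <= M)%N ->
    cabs (\sum_(k < M) u k - z) < e.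

Definition inH2 (a : nat -> C) : Prop := cvgn (series (fun k => (cabs (a k) ^+ 2 : R)) : R^nat).
Definition H2norm2 (a : nat -> C) : R := limn (series (fun k => (cabs (a k) ^+ 2 : R)) : R^nat).

Definition in_G0 (c : nat -> C) (Phi : C -> C) : Prop :=
  (forall eps : R, 0 < eps -> forall e : R, 0 < e ->
     exists N0 : nat, forall N : nat, (N0 <= N)%N ->
       forall s : C, eps < complex.Re s -> cabs (dpart c s N - Phi s) < e)
  /\ (forall s : C, 0 < complex.Re s -> 1 / 2 < complex.Re (Phi s)).

Definition DPhi_rel (Phi : C -> C) (a b : nat -> C) : Prop :=
  forall s : C, 1 / 2 < complex.Re s ->
    exists z : C, csum_to (dterm_deriv a (Phi s)) z /\ csum_to (dterm b s) z.

Definition DPhi_bounded (Phi : C -> C) : Prop :=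
  exists K : R, forall a : nat -> C, inH2 a ->
    exists b : nat -> C, [/\ inH2 b, DPhi_rel Phi a b & H2norm2 b <= K * H2norm2 a].

(* D_Phi is a compact operator on H^2: it is bounded, and the image of every
   bounded sequence has a subsequence that is Cauchy (hence convergent) in H^2 *)
Definition DPhi_compact (Phi : C -> C) : Prop :=
  DPhi_bounded Phi /\
  forall (a b : nat -> nat -> C),
    (forall k, inH2 (a k)) -> (forall k, H2norm2 (a k) <= 1) ->
    (forall k, inH2 (b k) /\ DPhi_rel Phi (a k) (b k)) ->
    exists phi : nat -> nat, (forall k, (phi k < phi k.+1)%N) /\
      forall e : R, 0 < e -> exists N : nat, forall i j : nat, (N <= i)%N -> (N <= j)%N ->
        H2norm2 (fun n => b (phi i) n - b (phi j) n) < e.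

Definition preim_box (Phi : C -> C) (w : C) (sigma T : R) : set C :=
  [set s | Phi s = w /\ `|complex.Im s| < T /\ sigma < complex.Re s].

Definition mean_counting (Phi : C -> C) (w : C) : \bar R :=
  lim ((lim (((pi / T)%:E *
               \esum_(s in preim_box Phi w sigma T) (complex.Re s)%:E)%E
             @[T --> +oo]))
       @[sigma --> 0^'+]).

End Dirichlet.

(* Main.v *)
Require Import Defs.
From HB Require Import structures.
From mathcomp Require Import all_boot all_order all_algebra.
From mathcomp Require Import complex.
From mathcomp Require Import all_classical all_reals all_analysis.
From mathcomp Require Import ring lra zify.
Import Order.TTheory GRing.Theory Num.Theory.
Import numFieldNormedType.Exports.
Local Open Scope ring_scope.
Local Open Scope complex_scope.

(** Let rho = Re w - 1/2. For a test function f with f'(w) = -1, every solution of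
    Phi(s) = w is a zero of F = 1 + f' o Phi, whose Dirichlet coefficients are those of
    1 + D_Phi f. A Jensen inequality in the mean bounds the zero-counting function of F,
    hence M_Phi(w), by a constant times
        ||F||^2 / |F(+oo)|^2 - 1 <= ||D_Phi f||^2 / |F(+oo)|^2.
    The f of minimal norm has ||f||^2 = 1 / sum_n (log n)^2 n^(-2 Re w), which is of order
    rho^3, and this gives both claims for small rho (for compactness: the normalised test
    functions tend weakly to 0, so their images tend to 0 in norm). For rho bounded
    below, the same inequality is applied to F = (Phi - w) / (Phi + w^* - 1), of modulus
    at most 1.

    The Jensen inequality is obtained without integrals: F is pulled back to the unit
    disc by the Cayley maps based at s0 + r + i y, approximated there by polynomials,
    and on a circle of radius < 1 one flips zeros with Blaschke factors and averages over
    roots of unity; then one averages over y in an arithmetic progression, on which the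
    means of |F|^2 are controlled by the coefficients of F. Only upper bounds along the
    limits defining M_Phi are needed, because a divergent [lim] in [\bar R] is 0. *)

(** The obstacle: [DPhi_rel] describes D_Phi f by its Dirichlet series only on Re s > 1/2, whereas
    M_Phi sees solutions with Re s arbitrarily close to 0. The bridge is uniform approximation.
    Since f is taken to be a Dirichlet polynomial, F is a uniform limit of Dirichlet polynomials on
    every half-plane Re s > s0 > 0, because Phi is one there and each n^(-u) is an exponential. Far
    to the right the approximants are compared with the series, so their coefficients are close to
    those of F, and the H^2 norm then controls the means of |F|^2 on all of Re s > s0. The same
    closure rules, after a Cayley map, give polynomial approximation on smaller discs, where
    Jensen's inequality is algebra.

    Dividing by |F(+oo)|^2 is safe for small rho because F(+oo) = 1 + t b_0 with |t b_0| <= 1/2. In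
    the other regime 1 / |F(+oo)|^2 - 1 = 4 rho (Re c_1 - 1/2) / |w - c_1|^2, which is where the
    excluded disc enters. The constants are crude but independent of s0, so sigma may tend to 0. *)

Section MeanCountingFunction.
Set Implicit Arguments.
Unset Strict Implicit.
Local Notation "z ^*" := (conjc z) : ring_scope.

(** * Modulus and complex exponential *)

Section Modulus.
Variable R : realType.
Local Notation C := R[i].
Implicit Types (x y t : R) (z u v : C).

Lemma cabsE z : cabs z = Normc.normc z.
Proof. by case: z. Qed.

Lemma sqr_cabs z : cabs z ^+ 2 = complex.Re z ^+ 2 + complex.Im z ^+ 2.
Proof. by rewrite sqr_sqrtr // addr_ge0 // sqr_ge0. Qed.

Lemma sqr_cabsC z : (cabs z ^+ 2)%:C = z * z^*.
Proof.
rewrite sqr_cabs; case: z => a b /=; apply/eqP; rewrite eq_complex /=.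
by apply/andP; split; apply/eqP; ring.
Qed.

Lemma cabs_ge0 z : 0 <= cabs z.
Proof. exact: sqrtr_ge0. Qed.

Lemma cabs0 : cabs (0 : C) = 0.
Proof. by rewrite /cabs /= expr0n /= addr0 sqrtr0. Qed.

Lemma cabs1 : cabs (1 : C) = 1.
Proof. by rewrite /cabs /= expr0n /= addr0 expr1n sqrtr1. Qed.

Lemma cabs_eq0 z : (cabs z == 0) = (z == 0).
Proof.
apply/eqP/eqP => [|->]; last exact: cabs0.
by rewrite cabsE => /Normc.eq0_normc.
Qed.

Lemma cabs_gt0 z : (0 < cabs z) = (z != 0).
Proof. by rewrite lt_neqAle cabs_ge0 andbT eq_sym cabs_eq0. Qed.

Lemma cabsM z u : cabs (z * u) = cabs z * cabs u.
Proof. by rewrite !cabsE Normc.normcM. Qed.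

Lemma cabsD z u : cabs (z + u) <= cabs z + cabs u.
Proof. by rewrite !cabsE; exact: le_normcD. Qed.

Lemma cabsN z : cabs (- z) = cabs z.
Proof. by rewrite !cabsE; exact: normcN. Qed.

Lemma cabsB z u : cabs (z - u) <= cabs z + cabs u.
Proof. by rewrite -(cabsN u) cabsD. Qed.

Lemma cabs_sub z u : cabs (z - u) = cabs (u - z).
Proof. by rewrite -cabsN opprB. Qed.

Lemma cabs_dist z u : cabs z <= cabs u + cabs (z - u).
Proof. by rewrite -{1}(subrK u z) addrC cabsD. Qed.

Lemma cabsV z : cabs z^-1 = (cabs z)^-1.
Proof. by rewrite !cabsE Normc.normcV. Qed.

Lemma cabs_conj z : cabs z^* = cabs z.
Proof. by rewrite /cabs; case: z => a b /=; rewrite sqrrN. Qed.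

Lemma cabs_real x : cabs x%:C = `|x|.
Proof. by rewrite /cabs /= expr0n /= addr0 sqrtr_sqr. Qed.

Lemma cabsX z n : cabs (z ^+ n) = cabs z ^+ n.
Proof. by elim: n => [|n IH]; rewrite ?expr0 ?cabs1 // !exprS cabsM IH. Qed.

Lemma cabs_sum (I : Type) (s : seq I) (P : pred I) (f : I -> C) :
  cabs (\sum_(i <- s | P i) f i) <= \sum_(i <- s | P i) cabs (f i).
Proof.
elim/big_rec2: _ => [|i a u _ h]; first by rewrite cabs0.
by rewrite (le_trans (cabsD _ _)) // lerD2l.
Qed.

Lemma cabs_prod (I : Type) (s : seq I) (P : pred I) (f : I -> C) :
  cabs (\prod_(i <- s | P i) f i) = \prod_(i <- s | P i) cabs (f i).
Proof. by apply: (big_morph (@cabs R)); [exact: cabsM | exact: cabs1]. Qed.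

Lemma Re_le_cabs z : `|complex.Re z| <= cabs z.
Proof. by rewrite -sqrtr_sqr ler_wsqrtr // lerDl sqr_ge0. Qed.

Lemma Im_le_cabs z : `|complex.Im z| <= cabs z.
Proof. by rewrite -sqrtr_sqr ler_wsqrtr // lerDr sqr_ge0. Qed.

Lemma cabs_le_ReIm z : cabs z <= `|complex.Re z| + `|complex.Im z|.
Proof.
rewrite -(@ler_pXn2r _ 2) // ?nnegrE ?cabs_ge0 ?addr_ge0 //.
rewrite sqr_cabs sqrrD !real_normK ?num_real //.
by rewrite lerD2r lerDl mulrn_wge0 // mulr_ge0.
Qed.

(* Young's inequality in the form needed to absorb uniform errors. *)
Lemma sqr_cabsD_le z u t : 0 < t ->
  cabs (z + u) ^+ 2 <= (1 + t) * cabs z ^+ 2 + (1 + t^-1) * cabs u ^+ 2.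
Proof.
move=> t0; apply: (@le_trans _ _ ((cabs z + cabs u) ^+ 2)).
  by rewrite ler_pXn2r ?nnegrE ?addr_ge0 ?cabs_ge0 // cabsD.
move: (cabs z) (cabs u) => a b; rewrite -subr_ge0.
have -> : (1 + t) * a ^+ 2 + (1 + t^-1) * b ^+ 2 - (a + b) ^+ 2 =
   t^-1 * (t * a - b) ^+ 2 by field; rewrite gt_eqF.
by rewrite mulr_ge0 ?sqr_ge0 ?invr_ge0 // ltW.
Qed.

Lemma cauchy_schwarz_sum (I : Type) (s : seq I) (f g : I -> R) :
  (\sum_(i <- s) f i * g i) ^+ 2 <=
  (\sum_(i <- s) f i ^+ 2) * (\sum_(i <- s) g i ^+ 2).
Proof.
elim: s => [|i s]; first by rewrite !big_nil mulr0 expr0n.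
rewrite !big_cons.
set X := \sum_(j <- s) _; set A := \sum_(j <- s) _; set B := \sum_(j <- s) _.
have A0 : 0 <= A by apply: sumr_ge0 => j _; exact: sqr_ge0.
have B0 : 0 <= B by apply: sumr_ge0 => j _; exact: sqr_ge0.
move: (f i) (g i) => a b h.
suff : 2 * (a * b * X) <= a ^+ 2 * B + b ^+ 2 * A by nra.
apply: (le_trans (ler_norm _)).
have pA : 0 <= b ^+ 2 * A by apply: mulr_ge0 => //; exact: sqr_ge0.
have pB : 0 <= a ^+ 2 * B by apply: mulr_ge0 => //; exact: sqr_ge0.
rewrite -(@ler_pXn2r _ 2) ?nnegrE ?addr_ge0 //.
rewrite real_normK ?num_real //.
apply: (@le_trans _ _ (4 * (a ^+ 2 * b ^+ 2) * (A * B))).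
  have -> : (2 * (a * b * X)) ^+ 2 = 4 * (a ^+ 2 * b ^+ 2) * X ^+ 2 by ring.
  by rewrite ler_wpM2l // mulr_ge0 // -exprMn sqr_ge0.
rewrite -subr_ge0.
have -> : (a ^+ 2 * B + b ^+ 2 * A) ^+ 2 - 4 * (a ^+ 2 * b ^+ 2) * (A * B) =
  (a ^+ 2 * B - b ^+ 2 * A) ^+ 2 by ring.
exact: sqr_ge0.
Qed.

Definition cexp z : C :=
  (expR (complex.Re z) * cos (complex.Im z)) +i*
  (expR (complex.Re z) * sin (complex.Im z)).

Lemma cexpD z u : cexp (z + u) = cexp z * cexp u.
Proof.
rewrite /cexp; case: z u => [a b] [c d] /=.
rewrite expRD cosD sinD; apply/eqP; rewrite eq_complex /=.
by apply/andP; split; apply/eqP; ring.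
Qed.

Lemma cexp0 : cexp 0 = 1.
Proof. by rewrite /cexp /= expR0 cos0 sin0 !mul1r. Qed.

Lemma cabs_cexp z : cabs (cexp z) = expR (complex.Re z).
Proof.
rewrite /cabs /cexp /= !exprMn -mulrDr cos2Dsin2 mulr1 sqrtr_sqr.
by rewrite ger0_norm // expR_ge0.
Qed.

Lemma cexp_mulrn z n : cexp (z *+ n) = cexp z ^+ n.
Proof. by elim: n => [|n IH]; rewrite ?cexp0 // mulrS cexpD IH exprS. Qed.

Lemma conj_cexp z : (cexp z)^* = cexp z^*.
Proof. by case: z => a b; rewrite /cexp /= cosN sinN mulrN. Qed.

Lemma npowE m (s : C) : npow m s = cexp (- (ln m%:R)%:C * s).
Proof.
case: s => a b; rewrite /npow /cexp /=.
have -> : - ln m%:R * a - - 0 * b = - a * ln (m%:R : R) by ring.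
have -> : - ln m%:R * b + - 0 * a = - (b * ln (m%:R : R)) by ring.
by rewrite cosN sinN mulrN.
Qed.

Lemma cabs_npow m (s : C) :
  cabs (npow m s) = expR (- complex.Re s * ln m%:R).
Proof.
rewrite npowE cabs_cexp; congr expR; case: s => a b /=.
by rewrite mulNr oppr0 mul0r subr0 mulNr mulrC.
Qed.

Lemma npowD m (s s' : C) : npow m (s + s') = npow m s * npow m s'.
Proof. by rewrite !npowE mulrDr cexpD. Qed.

Lemma npowM m n (s : C) : (0 < m)%N -> (0 < n)%N ->
  npow (m * n) s = npow m s * npow n s.
Proof.
move=> m0 n0; rewrite !npowE -cexpD natrM lnM ?posrE ?ltr0n //.
by rewrite -mulrDl rmorphD /= opprD.
Qed.

Lemma npow1 (s : C) : npow 1 s = 1.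
Proof. by rewrite npowE ln1 oppr0 mul0r cexp0. Qed.

Lemma conj_npow m (s : C) : (npow m s)^* = npow m s^*.
Proof.
rewrite !npowE conj_cexp; congr cexp; case: s => a b /=.
by apply/eqP; rewrite eq_complex /= -!mulNr !oppr0 !mul0r; apply/andP; split; apply/eqP; ring.
Qed.

Lemma ln_nat_ge0 m : 0 <= ln (m.+1%:R : R).
Proof. by rewrite ln_ge0 // ler1n. Qed.

Lemma cabs_npow_le1 m (s : C) : 0 <= complex.Re s -> cabs (npow m.+1 s) <= 1.
Proof.
move=> s0; rewrite cabs_npow -[leRHS]expR0 ler_expR mulNr oppr_le0.
by rewrite mulr_ge0 // ln_nat_ge0.
Qed.

Lemma abs_sin_le x : `|sin x| <= `|x|.
Proof.
wlog x0 : x / 0 <= x.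
  move=> h; case: (leP 0 x) => x0; first exact: h.
  by have := h (- x); rewrite sinN !normrN oppr_ge0; apply; exact: ltW.
rewrite (ger0_norm x0); move: x0; rewrite le_eqVlt => /predU1P[<-|x0].
  by rewrite sin0 normr0.
have dsin y : y \in `]0, x[ -> is_derive y 1 (@sin R) (cos y).
  by move=> _; exact: is_derive_sin.
have csin : {within `[0, x], continuous (@sin R)}%classic.
  by apply: continuous_subspaceT => y; exact: continuous_sin.
have [y _] := MVT x0 dsin csin; rewrite sin0 !subr0 => ->; rewrite normrM (gtr0_norm x0).
by rewrite ler_piMl ?cos_max // ltW.
Qed.

Lemma abs_1Bcos_le x : `|cos x - 1| <= x ^+ 2.
Proof.
have -> : cos x - 1 = - (2 * sin (x / 2) ^+ 2).
  rewrite {1}(splitr x) cosD -!expr2 cos2sin2; ring.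
rewrite normrN ger0_norm; last by rewrite pmulr_rge0 // sqr_ge0.
have := abs_sin_le (x / 2); rewrite -(@ler_pXn2r _ 2) ?nnegrE //.
rewrite !real_normK ?num_real // => h.
by have := sqr_ge0 x; nra.
Qed.

Lemma abs_sinBid_le x : `|sin x - x| <= `|x| ^+ 3.
Proof.
wlog x0 : x / 0 <= x.
  move=> h; case: (leP 0 x) => x0; first exact: h.
  have := h (- x); rewrite sinN -opprD !normrN oppr_ge0; apply; exact: ltW.
rewrite (ger0_norm x0); move: x0; rewrite le_eqVlt => /predU1P[<-|x0].
  by rewrite sin0 subr0 normr0 expr0n.
have dsin y : y \in `]0, x[ ->
    is_derive y 1 (fun y : R => sin y - y) (cos y - 1).
  by move=> _; apply: is_deriveB.
have csin : {within `[0, x], continuous (fun y : R => sin y - y)}%classic.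
  apply: continuous_subspaceT => y.
  by apply: cvgB; [exact: continuous_sin | exact: cvg_id].
have [y] := MVT x0 dsin csin; rewrite in_itv /= => /andP[y0 yx].
rewrite sin0 !subr0 => ->; rewrite normrM (gtr0_norm x0) exprSr.
rewrite ler_wpM2r ?(ltW x0) // (le_trans (abs_1Bcos_le _)) //.
by rewrite ler_pXn2r ?nnegrE ?ltW.
Qed.

Lemma abs_expRB1Bid_le x : `|x| <= 1 / 2 -> `|expR x - 1 - x| <= 2 * x ^+ 2.
Proof.
rewrite ler_norml => /andP[hx1 hx2].
have h1 := expR_ge1Dx x; have h2 := expR_ge1Dx (- x).
rewrite ger0_norm; last by lra.
have h3 : expR x * (1 - x) <= 1.
  by rewrite -[leRHS](expRxMexpNx_1 x) ler_wpM2l ?expR_ge0.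
have : (expR x - 1 - x) * (1 - x) <= x ^+ 2 by nra.
by have := sqr_ge0 x; nra.
Qed.

(** Real and imaginary parts are estimated separately, at the cost of 4 and 5 times [|z|^2]. Only
    the order 2 matters: it makes the [n] errors in [(1 + f / n) ^+ n] add up to O(1/n). *)
Lemma cabs_cexpB1Bid_le z : cabs z <= 1 / 2 ->
  cabs (cexp z - 1 - z) <= 9 * cabs z ^+ 2.
Proof.
move=> hz; have hR := Re_le_cabs z; have hI := Im_le_cabs z.
have hz0 := cabs_ge0 z.
apply: (le_trans (cabs_le_ReIm _)).
case: z hz hR hI hz0 => a b /=.
set r := cabs _ => hz hR hI hz0.
have ea : `|expR a - 1 - a| <= 2 * a ^+ 2.
  by apply: abs_expRB1Bid_le; exact: le_trans hR hz.
have cb := abs_1Bcos_le b; have sb := abs_sinBid_le b.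
have a2 : a ^+ 2 <= r ^+ 2.
  by rewrite -(real_normK (num_real a)) ler_pXn2r ?nnegrE.
have b2 : b ^+ 2 <= r ^+ 2.
  by rewrite -(real_normK (num_real b)) ler_pXn2r ?nnegrE.
have b3 : `|b| ^+ 3 <= r ^+ 2.
  rewrite exprSr (real_normK (num_real b)).
  apply: (@le_trans _ _ (r ^+ 2 * 1)); last by rewrite mulr1.
  by apply: ler_pM; rewrite ?sqr_ge0 //; lra.
have ea2 : expR a <= 2.
  move: ea hR; rewrite !ler_norml => /andP[_ h1] /andP[h2 h3].
  by nra.
have ea0 := expR_ge0 a.
have d1 : `|expR a * cos b - 1 - a| <= 4 * r ^+ 2.
  have -> : expR a * cos b - 1 - a = (expR a - 1 - a) + expR a * (cos b - 1).
    by ring.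
  apply: (le_trans (ler_normD _ _)); rewrite normrM (ger0_norm ea0).
  have : expR a * `|cos b - 1| <= 2 * r ^+ 2.
    by apply: ler_pM => //; exact: le_trans cb b2.
  by lra.
have d2 : `|expR a * sin b - 0 - b| <= 5 * r ^+ 2.
  have -> : expR a * sin b - 0 - b = expR a * (sin b - b) + (expR a - 1) * b.
    by ring.
  apply: (le_trans (ler_normD _ _)); rewrite !normrM (ger0_norm ea0).
  have h1 : expR a * `|sin b - b| <= 2 * r ^+ 2.
    by apply: ler_pM => //; exact: le_trans sb b3.
  have h2 : `|expR a - 1| <= 2 * r.
    have {}ea : - (2 * a ^+ 2) <= expR a - 1 - a <= 2 * a ^+ 2.
      by rewrite -ler_norml.
    have {}hR : - r <= a <= r by rewrite -ler_norml.
    have ar : a ^+ 2 <= r / 2 by nra.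
    by rewrite ler_norml; apply/andP; split; lra.
  have h3 : `|expR a - 1| * `|b| <= (2 * r) * r by apply: ler_pM.
  by nra.
by lra.
Qed.

End Modulus.

(** * Uniform closures of function algebras *)

Section UniformClosure.
Variable R : realType.
Local Notation C := R[i].

Lemma exprn_small (t e : R) : 0 <= t -> t < 1 -> 0 < e -> exists n : nat, t ^+ n < e.
Proof.
move=> t0 t1 e0.
have /cvgrPdist_lt/(_ e e0) : ((GRing.exp t : R^nat) @ \oo --> 0)%classic.
  by apply: cvg_expr; rewrite ger0_norm.
case=> N _ /(_ N (leqnn N)); rewrite sub0r normrN ger0_norm ?exprn_ge0 // => h.
by exists N.
Qed.

Lemma cabs_subX_le (a b : C) (r : R) n : 1 <= r -> cabs a <= r -> cabs b <= r ->
  cabs (a ^+ n - b ^+ n) <= n%:R * cabs (a - b) * r ^+ n.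
Proof.
move=> r1 ar br; have r0 : 0 <= r by apply: le_trans r1.
elim: n => [|n IH]; first by rewrite subrr cabs0 !mul0r.
have -> : a ^+ n.+1 - b ^+ n.+1 = a * (a ^+ n - b ^+ n) + (a - b) * b ^+ n.
  by rewrite !exprS; ring.
apply: (le_trans (cabsD _ _)); rewrite !cabsM cabsX.
have h1 : cabs a * cabs (a ^+ n - b ^+ n) <= r * (n%:R * cabs (a - b) * r ^+ n).
  by apply: ler_pM => //; exact: cabs_ge0.
have h2 : cabs (a - b) * cabs b ^+ n <= cabs (a - b) * r ^+ n.+1.
  apply: ler_wpM2l; first exact: cabs_ge0.
  apply: (@le_trans _ _ (r ^+ n)).
    by rewrite lerXn2r ?nnegrE ?cabs_ge0.
  by rewrite exprS ler_peMl // exprn_ge0.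
apply: (le_trans (lerD h1 h2)); rewrite -subr_ge0.
rewrite [X in 0 <= X](_ : _ = 0) // -natr1 exprS; ring.
Qed.

(** Stands in for holomorphy throughout. It is used with polynomials on a disc and with Dirichlet
    polynomials on a half-plane, so the closure rules below are proved once for both. *)
Definition uclos (X : Type) (D : X -> Prop) (A : (X -> C) -> Prop) (f : X -> C) : Prop :=
  forall e : R, 0 < e -> exists2 g, A g & forall x, D x -> cabs (f x - g x) <= e.

Record bounded_algebra (X : Type) (D : X -> Prop) (A : (X -> C) -> Prop) : Prop :=
  BoundedAlgebra {
    ba_cst : forall c : C, A (fun=> c);
    ba_add : forall f g, A f -> A g -> A (fun x => f x + g x);
    ba_mul : forall f g, A f -> A g -> A (fun x => f x * g x);
    ba_bdd : forall f, A f -> exists M : R, forall x, D x -> cabs (f x) <= M }.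

Variables (X : Type) (D : X -> Prop) (A : (X -> C) -> Prop).
Hypothesis AD : bounded_algebra D A.
Local Notation cl := (uclos D A).

Lemma uclos_sub f : A f -> cl f.
Proof.
by move=> Af e e0; exists f => // x _; rewrite subrr cabs0 ltW.
Qed.

Lemma uclos_cst c : cl (fun=> c).
Proof. by apply: uclos_sub; exact: (ba_cst AD). Qed.

Lemma uclos_lim f : (forall e : R, 0 < e ->
  exists2 g, cl g & forall x, D x -> cabs (f x - g x) <= e) -> cl f.
Proof.
move=> h e e0; have e2 : 0 < e / 2 by rewrite divr_gt0.
have [g cg fg] := h _ e2; have [k Ak gk] := cg _ e2.
exists k => // x Dx; rewrite [e]splitr.
have -> : f x - k x = (f x - g x) + (g x - k x) by ring.
by rewrite (le_trans (cabsD _ _)) // lerD ?fg ?gk.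
Qed.

Lemma uclos_eq f g : (forall x, D x -> f x = g x) -> cl f -> cl g.
Proof.
move=> fg cf; apply: uclos_lim => e e0; exists f => // x Dx.
by rewrite fg // subrr cabs0 ltW.
Qed.

Lemma uclos_bdd f : cl f -> exists2 M : R, 0 < M & forall x, D x -> cabs (f x) <= M.
Proof.
move=> /(_ 1 ltr01)[g /(ba_bdd AD)[M gM] fg].
exists (`|M| + 1) => [|x Dx]; first by rewrite ltr_wpDl.
have := cabs_dist (f x) (g x); have := gM x Dx; have := fg x Dx.
by have := ler_norm M; lra.
Qed.

Lemma uclos_add f g : cl f -> cl g -> cl (fun x => f x + g x).
Proof.
move=> cf cg e e0; have e2 : 0 < e / 2 by rewrite divr_gt0.
have [f1 Af1 h1] := cf _ e2; have [g1 Ag1 h2] := cg _ e2.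
exists (fun x => f1 x + g1 x) => [|x Dx]; first exact: (ba_add AD).
have -> : f x + g x - (f1 x + g1 x) = (f x - f1 x) + (g x - g1 x) by ring.
by rewrite [e]splitr (le_trans (cabsD _ _)) // lerD ?h1 ?h2.
Qed.

Lemma uclos_mul f g : cl f -> cl g -> cl (fun x => f x * g x).
Proof.
move=> cf cg; have [M M0 fM] := uclos_bdd cf.
apply: uclos_lim => e e0.
(* The order matters: the tolerance for [f] depends on a bound [N] of the approximant [g1], so [g1]
   is chosen first. *)
have [g1 Ag1 h2] := cg (e / (2 * M)) (divr_gt0 e0 (mulr_gt0 (ltr0n _ 2) M0)).
have [N N0 gN] := uclos_bdd (uclos_sub Ag1).
have [f1 Af1 h1] := cf (e / (2 * N)) (divr_gt0 e0 (mulr_gt0 (ltr0n _ 2) N0)).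
exists (fun x => f1 x * g1 x) => [|x Dx].
  by apply: uclos_sub; exact: (ba_mul AD).
have -> : f x * g x - f1 x * g1 x = f x * (g x - g1 x) + (f x - f1 x) * g1 x by ring.
rewrite [e]splitr (le_trans (cabsD _ _)) // !cabsM lerD //.
  have -> : e / 2 = M * (e / (2 * M)) by field; rewrite gt_eqF.
  by apply: ler_pM; rewrite ?cabs_ge0 ?fM ?h2.
have -> : e / 2 = (e / (2 * N)) * N by field; rewrite gt_eqF.
by apply: ler_pM; rewrite ?cabs_ge0 ?gN ?h1.
Qed.

Lemma uclos_exprn f n : cl f -> cl (fun x => f x ^+ n).
Proof.
move=> cf; elim: n => [|n IH]; first exact: uclos_cst.
by apply: uclos_eq (uclos_mul cf IH) => x _; rewrite exprS.
Qed.

Lemma uclos_sum n (f : nat -> X -> C) : (forall k, cl (f k)) ->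
  cl (fun x => \sum_(k < n) f k x).
Proof.
move=> cf; elim: n => [|n IH].
  by apply: uclos_eq (uclos_cst 0) => x _; rewrite big_ord0.
by apply: uclos_eq (uclos_add IH (cf n)) => x _; rewrite big_ord_recr.
Qed.

(* [cexp f] is the uniform limit of [(1 + f / n) ^+ n]. *)
Lemma uclos_cexp f : cl f -> cl (fun x => cexp (f x)).
Proof.
move=> cf; have [M M0 fM] := uclos_bdd cf.
apply: uclos_lim => e e0.
(* Two demands on [n]: [n >= 2 M] gives [|f / n| <= 1 / 2], where the quadratic remainder bound
   holds, and the second term brings the total error [9 M^2 e^M / n] below [e]. *)
pose K := 2 * M + 9 * M ^+ 2 * expR M / e.
have K0 : 0 <= K.
  by rewrite addr_ge0 // ?mulr_ge0 ?invr_ge0 ?sqr_ge0 ?expR_ge0 ?(ltW e0) ?(ltW M0).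
pose n := (Num.trunc K).+1.
have nK : K < n%:R by exact: truncnS_gt.
have n0 : 0 < n%:R :> R by rewrite ltr0n.
exists (fun x => (1 + (n%:R^-1)%:C * f x) ^+ n).
  apply: uclos_exprn; apply: uclos_add; first exact: uclos_cst.
  by apply: uclos_mul => //; exact: uclos_cst.
move=> x Dx; set u := (n%:R^-1)%:C * f x.
have fE : f x = u *+ n.
  rewrite /u -mulr_natl mulrA -[n%:R * _](_ : (n%:R * n%:R^-1)%:C = _).
    by rewrite divff ?mul1r ?gt_eqF.
  by rewrite rmorphM /= rmorph_nat.
have cu : cabs u = cabs (f x) / n%:R.
  by rewrite cabsM cabs_real ger0_norm ?invr_ge0 ?(ltW n0) // mulrC.
have uM : cabs u <= M / n%:R by rewrite cu ler_pM2r ?invr_gt0 ?fM.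
have T0 : 0 <= 9 * M ^+ 2 * expR M / e.
  apply: divr_ge0 (ltW e0); apply: mulr_ge0 (expR_ge0 _).
  by rewrite pmulr_rge0 // sqr_ge0.
have u2 : cabs u <= 1 / 2.
  apply: (le_trans uM); rewrite ler_pdivrMr //.
  by move: nK; rewrite /K; lra.
rewrite fE cexp_mulrn.
have r1 : 1 <= expR (M / n%:R).
  by rewrite -[leLHS]expR0 ler_expR divr_ge0 // ltW.
apply: (le_trans (cabs_subX_le n r1 _ _)).
- rewrite cabs_cexp ler_expR (le_trans (ler_norm _)) //.
  exact: le_trans (Re_le_cabs _) uM.
- apply: (le_trans (cabsD _ _)); rewrite cabs1.
  apply: le_trans (expR_ge1Dx _); exact: lerD.
rewrite -expRM_natr divfK ?gt_eqF //.
have -> : cexp u - (1 + u) = cexp u - 1 - u by ring.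
have h : cabs (cexp u - 1 - u) <= 9 * (M / n%:R) ^+ 2.
  apply: (le_trans (cabs_cexpB1Bid_le u2)).
  by rewrite ler_pM2l // lerXn2r ?nnegrE ?cabs_ge0 // divr_ge0 // ltW.
apply: (@le_trans _ _ (n%:R * (9 * (M / n%:R) ^+ 2) * expR M)).
  by rewrite ler_wpM2r ?expR_ge0 // ler_wpM2l // ltW.
have -> : n%:R * (9 * (M / n%:R) ^+ 2) * expR M = 9 * M ^+ 2 * expR M / n%:R.
  by field; rewrite gt_eqF.
rewrite ler_pdivrMr // -ler_pdivrMl // [leLHS]mulrC.
by apply: ltW; apply: le_lt_trans nK; rewrite /K lerDr mulr_ge0 // ltW.
Qed.

(* [1 / f = (1 / b) * sum_k (1 - f / b) ^+ k] for [b] large, since [f] is bounded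
   with real part bounded below. *)
Lemma uclos_inv f (m : R) : 0 < m -> (forall x, D x -> m <= complex.Re (f x)) ->
  cl f -> cl (fun x => (f x)^-1).
Proof.
move=> m0 fm cf; have [M0 M00 fM0] := uclos_bdd cf.
pose M := M0 + m.
have MM : 0 < M by rewrite addr_gt0.
have fM x : D x -> cabs (f x) <= M by move=> /fM0; rewrite /M; lra.
(* This [b] minimises the bound [1 - 2 m / b + M^2 / b^2] for [|1 - f / b|^2]. The minimum is
   [1 - q], at most [(1 - q / 2)^2], which gives the geometric ratio. *)
have [b bE] : {b | b = M ^+ 2 / m} by exists (M ^+ 2 / m).
have b0 : 0 < b by rewrite bE divr_gt0 // exprn_gt0.
pose q := m ^+ 2 / M ^+ 2.
have q0 : 0 < q by rewrite divr_gt0 // exprn_gt0.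
have q1 : q <= 1.
  rewrite ler_pdivrMr ?exprn_gt0 // mul1r lerXn2r ?nnegrE ?ltW // /M; lra.
apply: uclos_lim => e e0.
have [n tn] : exists n : nat, (1 - q / 2) ^+ n < e * m.
  by apply: exprn_small; [lra|lra|rewrite mulr_gt0].
exists (fun x => (b^-1)%:C * \sum_(k < n) (1 - (b^-1)%:C * f x) ^+ k).
  apply: uclos_mul; first exact: uclos_cst.
  apply: (uclos_sum n (f := fun k x => (1 - (b^-1)%:C * f x) ^+ k)) => k.
  apply: uclos_exprn; apply: uclos_add; first exact: uclos_cst.
  apply: (@uclos_eq (fun x => (- b^-1)%:C * f x)).
    by move=> x _; rewrite rmorphN /= mulNr.
  by apply: uclos_mul => //; exact: uclos_cst.
move=> x Dx; set v := 1 - _.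
have fx0 : f x != 0.
  apply/eqP => f0; have := fm x Dx; rewrite f0 /=; lra.
have bf : (b^-1)%:C * f x = 1 - v by rewrite /v; ring.
have bC : (b^-1)%:C != 0 :> C.
  by rewrite -cabs_eq0 cabs_real normr_eq0 invr_eq0 gt_eqF.
have v1 : 1 - v != 0 by rewrite -bf mulf_neq0.
have -> : (f x)^-1 - (b^-1)%:C * \sum_(k < n) v ^+ k = v ^+ n / f x.
  have -> : (f x)^-1 = (b^-1)%:C / (1 - v).
    by rewrite -bf invfM mulrA divff ?mul1r.
  have := subrX1 v n; rewrite -(opprB 1 (v ^+ n)) -(opprB 1 v) mulNr.
  move/oppr_inj => sv.
  apply: (mulIf v1); rewrite mulrBl divfK // mulrA divfK //.
  by rewrite -mulrA [X in _ * X]mulrC -sv; ring.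
have hv : cabs v <= 1 - q / 2.
  rewrite -(@ler_pXn2r _ 2) ?nnegrE ?cabs_ge0 //; last by lra.
  apply: (@le_trans _ _ (1 - q)); last by have := sqr_ge0 q; nra.
  have := fm x Dx; have := fM x Dx.
  rewrite -(@ler_pXn2r _ 2) ?nnegrE ?cabs_ge0 ?(ltW MM) //.
  rewrite !sqr_cabs /v; case: (f x) => s t /= => h1 h2.
  have -> : (1 - (b^-1 * s - 0 * t)) ^+ 2 + (0 - (b^-1 * t + 0 * s)) ^+ 2 =
     1 - 2 * s / b + (s ^+ 2 + t ^+ 2) / b ^+ 2 by field; rewrite gt_eqF.
  have -> : 1 - q = 1 - 2 * m / b + M ^+ 2 / b ^+ 2.
    by rewrite bE /q; field; rewrite !gt_eqF.
  rewrite lerD // ?lerD2l ?lerN2.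
    by rewrite ler_pM2r ?invr_gt0 // ler_pM2l.
  by rewrite ler_pM2r // invr_gt0 exprn_gt0.
rewrite cabsM cabsV cabsX ler_pdivrMr ?cabs_gt0 //.
apply: (@le_trans _ _ (e * m)).
  apply: le_trans (ltW tn).
  by rewrite lerXn2r ?nnegrE ?cabs_ge0 //; lra.
rewrite ler_pM2l // (le_trans (fm x Dx)) // (le_trans (ler_norm _)) //.
exact: Re_le_cabs.
Qed.

End UniformClosure.

(** * Jensen inequality for polynomials and in the disc *)

Section PolynomialJensen.
Variable R : realType.
Local Notation C := R[i].

Definition unity_root (N : nat) : C := cexp (0 +i* (pi *+ 2 / N%:R)).

Lemma cabs_unity_root N k : cabs (unity_root N ^+ k) = 1.
Proof. by rewrite cabsX cabs_cexp expR0 expr1n. Qed.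

Lemma unity_rootX N k : unity_root N ^+ k = cexp (0 +i* (pi *+ 2 / N%:R * k%:R)).
Proof.
rewrite -cexp_mulrn; congr cexp; elim: k => [|k IH].
  by rewrite mulr0.
rewrite mulrS IH; apply/eqP; rewrite eq_complex /= addr0 eqxx /=.
by rewrite -natr1; apply/eqP; ring.
Qed.

Lemma unity_rootXN N : (0 < N)%N -> unity_root N ^+ N = 1.
Proof.
move=> N0; rewrite unity_rootX divfK ?pnatr_eq0 -?lt0n //.
by rewrite /cexp /= expR0 cos2pi sin2pi !mul1r.
Qed.

Lemma unity_rootX_neq1 N k : (0 < k < N)%N -> unity_root N ^+ k != 1.
Proof.
move=> /andP[k0 kN]; rewrite unity_rootX.
have N0 : (0 < N%:R :> R) by rewrite ltr0n (leq_trans _ kN).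
apply/eqP => /(congr1 (@complex.Re R)) /=; rewrite expR0 mul1r.
pose x : R := pi * (k%:R / N%:R).
have -> : pi *+ 2 / N%:R * k%:R = x *+ 2 by rewrite /x !mulr2n; ring.
rewrite cos_mulr2n => h.
have /sin_gt0_pi : 0 < x < pi.
  rewrite /x; apply/andP; split.
    by rewrite mulr_gt0 ?pi_gt0 // divr_gt0 // ltr0n.
  by rewrite -[ltRHS]mulr1 ltr_pM2l ?pi_gt0 // ltr_pdivrMr // mul1r ltr_nat.
have := cos2Dsin2 x; nra.
Qed.

Lemma sum_unity_root N j : (0 < N)%N -> (j < N)%N ->
  \sum_(k < N) (unity_root N ^+ k) ^+ j = if j == 0%N then N%:R else 0.
Proof.
move=> N0 jN; case: eqP => [->|/eqP j0].
  by rewrite (eq_bigr (fun=> 1)) ?sumr_const ?card_ord.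
rewrite (eq_bigr (fun k : 'I_N => (unity_root N ^+ j) ^+ k)); last first.
  by move=> k _; rewrite -!exprM mulnC.
have := subrX1 (unity_root N ^+ j) N.
rewrite exprAC unity_rootXN // expr1n subrr => /esym/eqP.
rewrite mulf_eq0 subr_eq0 (negbTE (unity_rootX_neq1 _)) ?jN ?lt0n ?j0 //=.
by move/eqP.
Qed.

(** The mean value property is exact as soon as [N] exceeds the degree, every power between 1 and
    [N - 1] averaging to 0. This replaces circle integrals. *)
Lemma poly_circle_sum (P : {poly C}) N (r : C) : (0 < N)%N -> (size P <= N)%N ->
  \sum_(k < N) P.[r * unity_root N ^+ k] = N%:R * P.[0].
Proof.
move=> N0 PN.
under eq_bigr => k _.
  rewrite (horner_coef_wide _ PN).
  under eq_bigr => j _ do rewrite exprMn mulrA.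
  over.
rewrite exchange_big /=; under eq_bigr => j _ do rewrite -mulr_sumr sum_unity_root //.
case: N N0 PN => // N _ PN.
rewrite big_ord_recl /= expr0 mulr1 big1 ?addr0 => [|j _]; last by rewrite mulr0.
by rewrite mulrC -horner_coef0.
Qed.

Lemma poly_circle_mean (P : {poly C}) N (r : C) : (0 < N)%N -> (size P <= N)%N ->
  cabs P.[0] ^+ 2 <= N%:R^-1 * \sum_(k < N) cabs P.[r * unity_root N ^+ k] ^+ 2.
Proof.
move=> N0 PN; have N1 : 0 < N%:R :> R by rewrite ltr0n.
have h : N%:R * cabs P.[0] <= \sum_(k < N) cabs P.[r * unity_root N ^+ k].
  have <- : cabs (N%:R * P.[0]) = N%:R * cabs P.[0].
    by rewrite cabsM -[N%:R in LHS](rmorph_nat (real_complex R)) cabs_real normr_nat.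
  by rewrite -(poly_circle_sum r) // cabs_sum.
have := cauchy_schwarz_sum (index_enum 'I_N) (fun=> 1)
  (fun k : 'I_N => cabs P.[r * unity_root N ^+ k]).
under eq_bigr do rewrite mul1r.
under [X in _ <= X * _]eq_bigr do rewrite expr1n.
rewrite sumr_const card_ord => cs.
rewrite mulrC ler_pdivlMr // -(ler_pM2l N1); apply: le_trans cs.
apply: (@le_trans _ _ ((N%:R * cabs P.[0]) ^+ 2)); first by rewrite exprMn; lra.
rewrite ler_pXn2r ?nnegrE ?sumr_ge0 //; last by move=> k _; exact: cabs_ge0.
by rewrite mulr_ge0 ?cabs_ge0.
Qed.

(** Jensen's formula without logarithms: it combines [- ln t >= 1 - t] with [exp x >= 1 + x]. The
    product form remains meaningful when some [t i] is 0, that is, for a zero at the origin. *)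
Lemma prod_mul_1Dsum_le1 (I : Type) (s : seq I) (t : I -> R) :
  (forall i, 0 <= t i) -> all (fun i => t i <= 1) s ->
  (\prod_(i <- s) t i) * (1 + \sum_(i <- s) (1 - t i)) <= 1.
Proof.
move=> t0 ts.
suff : 0 <= \prod_(i <- s) t i <= 1 /\
  (\prod_(i <- s) t i) * (1 + \sum_(i <- s) (1 - t i)) <= 1 by case.
elim: s ts => [|i s IH] /=.
  by rewrite !big_nil addr0 mulr1 ler01 lexx.
move=> /andP[ti1 /IH[]]; rewrite !big_cons.
move: (t i) (t0 i) ti1 (\prod_(j <- s) _) (\sum_(j <- s) _) => a a0 a1 p S.
move=> /andP[p0 p1] h; split.
  by rewrite mulr_ge0 //= mulr_ile1.
have : a * (p * (1 + S)) <= a * 1 by apply: ler_wpM2l.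
have : a * (1 - a) * p <= a * (1 - a) * 1.
  by apply: ler_wpM2l => //; apply: mulr_ge0 => //; rewrite subr_ge0.
by have := sqr_ge0 (1 - a); nra.
Qed.

(* Replacing each factor [x - z] by [rho^2 - z^* x] multiplies the modulus on the
   circle |x| = rho by rho, and only increases the value at the origin. *)
Lemma poly_jensen (P : {poly C}) N (rho : R) (zs : seq C) :
  (0 < N)%N -> (size P <= N)%N -> 0 < rho -> uniq zs ->
  all (root P) zs -> all (fun z => cabs z <= rho) zs ->
  cabs P.[0] ^+ 2 * (1 + \sum_(z <- zs) (1 - cabs z ^+ 2 / rho ^+ 2)) <=
  N%:R^-1 * \sum_(k < N) cabs P.[rho%:C * unity_root N ^+ k] ^+ 2.
Proof.
move=> N0 PN rho0 uzs rts zrho.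
have [Q PQ] : exists Q, P = Q * \prod_(z <- zs) ('X - z%:P).
  by apply: uniq_roots_prod_XsubC; rewrite ?uniq_rootsE.
have [Q0|Q0] := eqVneq Q 0.
  rewrite PQ Q0 mul0r horner0 cabs0 expr0n /= mul0r mulr_ge0 ?invr_ge0 ?ler0n //.
  by apply: sumr_ge0 => k _; exact: sqr_ge0.
pose B : {poly C} := \prod_(z <- zs) ((rho ^+ 2)%:C%:P - z^* *: 'X).
have sB : (size B <= (size zs).+1)%N.
  rewrite /B; elim: (zs) => [|z s IH]; first by rewrite big_nil size_poly1.
  rewrite big_cons (leq_trans (size_polyMleq _ _)) //.
  have h : (size (((rho ^+ 2)%:C)%:P - z^* *: 'X : {poly C})%R <= 2)%N.
    rewrite (leq_trans (size_polyD _ _)) // geq_max size_polyN.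
    rewrite (leq_trans (size_polyC_leq1 _)) //.
    by rewrite (leq_trans (size_scale_leq _ _)) // size_polyX.
  rewrite /=; move: h IH; set u := size _; set v := size _ => h IH.
  by rewrite -ltnS (leq_trans (leqSpred _)) // -(addn2 (size s)) addnC; lia.
(* Flipping zeros does not raise the degree, so the same [N] sample points still average [Q * B]
   exactly. *)
have sP : (size (Q * B)%R <= N)%N.
  have sZ : size (\prod_(z <- zs) ('X - z%:P)) = (size zs).+1.
    exact: (size_prod_XsubC zs id).
  have Z0 : \prod_(z <- zs) ('X - z%:P) != 0 by rewrite -size_poly_eq0 sZ.
  have : size P = (size Q + (size zs).+1).-1 by rewrite [in LHS]PQ size_mul // sZ.
  move=> sPE; apply: leq_trans PN; rewrite sPE.
  apply: leq_trans (size_polyMleq Q B) _.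
  by rewrite -!subn1 leq_sub2r // leq_add2l.
have mB (x : C) : cabs x = rho ->
    cabs (Q * B).[x] = rho ^+ size zs * cabs P.[x].
  move=> xr; rewrite PQ !hornerM !cabsM mulrCA; congr (_ * _).
  rewrite /B !horner_prod !cabs_prod; elim: (zs) => [|z s IH].
    by rewrite !big_nil expr0 mulr1.
  rewrite !big_cons IH !hornerE.
  have -> : cabs ((rho ^+ 2)%:C - z^* * x) = rho * cabs (x - z).
    have -> : (rho ^+ 2)%:C - z^* * x = x * (x - z)^*.
      by rewrite -xr sqr_cabsC rmorphB /=; ring.
    by rewrite cabsM cabs_conj xr.
  by rewrite /= exprS; ring.
have B0 : cabs (Q * B).[0] = cabs Q.[0] * (rho ^+ 2) ^+ size zs.
  rewrite hornerM cabsM /B horner_prod cabs_prod; congr (_ * _).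
  elim: (zs) => [|z s IH]; first by rewrite big_nil.
  by rewrite big_cons IH !hornerE subr0 cabs_real ger0_norm ?sqr_ge0 //= [RHS]exprS.
have P0 : cabs P.[0] = cabs Q.[0] * \prod_(z <- zs) cabs z.
  rewrite PQ hornerM cabsM horner_prod cabs_prod; congr (_ * _).
  by apply: eq_bigr => z _; rewrite !hornerE cabsN.
have rhoX m : 0 < rho ^+ m by exact: exprn_gt0.
have main : cabs Q.[0] ^+ 2 * (rho ^+ 2) ^+ size zs <=
    N%:R^-1 * \sum_(k < N) cabs P.[rho%:C * unity_root N ^+ k] ^+ 2.
  have := poly_circle_mean (rho%:C) N0 sP; rewrite B0.
  have -> : \sum_(k < N) cabs (Q * B).[rho%:C * unity_root N ^+ k] ^+ 2 =
      (rho ^+ 2) ^+ size zs *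
      \sum_(k < N) cabs P.[rho%:C * unity_root N ^+ k] ^+ 2.
    rewrite mulr_sumr; apply: eq_bigr => k _.
    have xr : cabs (rho%:C * unity_root N ^+ k) = rho.
      by rewrite cabsM cabs_unity_root mulr1 cabs_real gtr0_norm.
    by rewrite (mB _ xr) exprMn -!exprM mulnC.
  move: (\sum_(k < N) _) => S h.
  by rewrite -(ler_pM2l (exprn_gt0 (size zs) (rhoX 2))); nra.
apply: le_trans main; rewrite P0 exprMn -mulrA ler_wpM2l ?sqr_ge0 //.
rewrite -prodrXl.
have -> : \prod_(z <- zs) cabs z ^+ 2 =
    (rho ^+ 2) ^+ size zs * \prod_(z <- zs) (cabs z ^+ 2 / rho ^+ 2).
  elim: (zs) => [|z s IH]; first by rewrite !big_nil mulr1.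
  by rewrite !big_cons IH /= (exprS (rho ^+ 2)); field; rewrite gt_eqF.
rewrite -mulrA; apply: ler_piMr; first by rewrite exprn_ge0 // sqr_ge0.
apply: prod_mul_1Dsum_le1 => [z|]; first by rewrite divr_ge0 ?sqr_ge0.
apply/allP => z /(allP zrho) hz; rewrite ler_pdivrMr // mul1r.
by rewrite lerXn2r ?nnegrE ?cabs_ge0 // ltW.
Qed.

End PolynomialJensen.

Section DiscJensen.
Variable R : realType.
Local Notation C := R[i].

Definition disc (rho : R) (z : C) : Prop := cabs z <= rho.
Definition is_poly (f : C -> C) : Prop := exists P : {poly C}, forall z, f z = P.[z].

Lemma poly_bdd (P : {poly C}) (rho : R) : exists M : R, forall z, disc rho z -> cabs P.[z] <= M.
Proof.
elim/poly_ind: P => [|P c [M PM]].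
  by exists 0 => z _; rewrite horner0 cabs0.
exists (M * rho + cabs c) => z hz; rewrite !hornerE.
rewrite (le_trans (cabsD _ _)) // lerD2r cabsM.
by apply: ler_pM; rewrite ?cabs_ge0 ?PM.
Qed.

Lemma poly_bounded_algebra rho : bounded_algebra (disc rho) is_poly.
Proof.
split.
- by move=> c; exists c%:P => z; rewrite hornerC.
- by move=> f g [P fP] [Q gQ]; exists (P + Q) => z; rewrite hornerD fP gQ.
- by move=> f g [P fP] [Q gQ]; exists (P * Q) => z; rewrite hornerM fP gQ.
- by move=> f [P fP]; have [M PM] := poly_bdd P rho; exists M => z /PM; rewrite fP.
Qed.

(** Newton interpolation, one node at a time. The point is that [K] depends on the nodes and [rho]
    only, so small prescribed values give a uniformly small interpolant. *)
Lemma poly_interpolation (rho : R) (zs : seq C) : uniq zs ->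
  (forall z, z \in zs -> disc rho z) ->
  exists2 K : R, 0 <= K & forall (e : R) (v : C -> C), 0 <= e ->
    (forall z, z \in zs -> cabs (v z) <= e) ->
    exists L : {poly C}, [/\ (size L <= size zs)%N,
      forall z, z \in zs -> L.[z] = v z &
      forall z, disc rho z -> cabs L.[z] <= K * e].
Proof.
elim: zs => [_ _|a zs IH /= /andP[azs uzs] zsD].
  exists 0 => // e v _ _; exists 0; split=> //; first by rewrite size_poly0.
  by move=> z _; rewrite horner0 cabs0 mul0r.
have [z zzs|K K0 HK] := IH uzs; first by apply: zsD; rewrite inE zzs orbT.
have aD : disc rho a by apply: zsD; rewrite inE eqxx.
pose M : {poly C} := \prod_(z <- zs) ('X - z%:P).
have Ma : 0 < cabs M.[a] by rewrite cabs_gt0 -rootE root_prod_XsubC.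
have [B MB] := poly_bdd M rho.
have B0 : 0 <= B by apply: le_trans (MB a aD); exact: cabs_ge0.
exists (K + (1 + K) / cabs M.[a] * B).
  by rewrite addr_ge0 // mulr_ge0 // divr_ge0 ?cabs_ge0 // addr_ge0.
move=> e v e0 ve.
have [|L [sL Lv LK]] := HK e v e0.
  by move=> z zzs; apply: ve; rewrite inE zzs orbT.
pose c := (v a - L.[a]) / M.[a].
have M0 : M.[a] != 0 by rewrite -cabs_gt0.
exists (L + c *: M); split.
- rewrite (leq_trans (size_polyD _ _)) // geq_max (leq_trans sL) //=.
  rewrite (leq_trans (size_scale_leq _ _)) //.
  by rewrite (size_prod_XsubC zs id).
- move=> z; rewrite inE hornerD hornerZ => /predU1P[->|zzs].
    by rewrite /c divfK // addrC subrK.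
  have -> : M.[z] = 0 by apply/eqP; rewrite -rootE root_prod_XsubC.
  by rewrite mulr0 addr0 Lv.
- move=> z zD; rewrite hornerD hornerZ (le_trans (cabsD _ _)) // mulrDl lerD ?LK //.
  rewrite cabsM mulrAC; apply: ler_pM; rewrite ?cabs_ge0 ?MB //.
  rewrite /c cabsM cabsV mulrAC ler_pM2r ?invr_gt0 //.
  rewrite (le_trans (cabsB _ _)) // mulrDl mul1r lerD ?LK //.
  by apply: ve; rewrite inE eqxx.
Qed.

Lemma sqr_le_perturb (x y n B : R) : 0 <= x -> 0 <= y -> y <= B -> 0 <= n ->
  n <= 1 -> x <= y + n -> x ^+ 2 <= y ^+ 2 + n * (2 * B + 1).
Proof.
move=> x0 y0 yB n0 n1 xyn.
have : x ^+ 2 <= (y + n) ^+ 2 by rewrite lerXn2r ?nnegrE ?addr_ge0.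
have : n * y <= n * B by rewrite ler_wpM2l.
have : n * n <= n * 1 by rewrite ler_wpM2l.
by lra.
Qed.

(* A polynomial approximation of [G] is corrected by interpolation so as to vanish
   exactly at the given zeros of [G]. *)
Lemma disc_jensen (G : C -> C) (rho e : R) (zs : seq C) : 0 < rho ->
  uclos (disc rho) is_poly G -> uniq zs ->
  (forall z, z \in zs -> disc rho z /\ G z = 0) -> 0 < e ->
  exists N0 : nat, forall N, (0 < N)%N -> (N0 <= N)%N ->
    cabs (G 0) ^+ 2 * (1 + \sum_(z <- zs) (1 - cabs z ^+ 2 / rho ^+ 2)) <=
    N%:R^-1 * \sum_(k < N) cabs (G (rho%:C * unity_root R N ^+ k)) ^+ 2 + e.
Proof.
move=> rho0 cG uzs zsG e0.
have [B B0 GB] := uclos_bdd (poly_bounded_algebra rho) cG.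
have [|K K0 HK] := @poly_interpolation rho _ uzs; first by move=> z /zsG[].
set W := 1 + _.
have W1 : 1 <= W.
  rewrite lerDl big_seq_cond; apply: sumr_ge0 => z; rewrite andbT => /zsG[zD _].
  rewrite subr_ge0 ler_pdivrMr ?exprn_gt0 // mul1r.
  by rewrite lerXn2r ?nnegrE ?cabs_ge0 // ltW.
pose B1 := 2 * (B + 1) + 1.
have B10 : 0 < B1 by rewrite /B1; lra.
(* A uniform error [n] costs [n * B1] in each square. It is paid once on the circle and once at the
   origin, there multiplied by [W >= 1]. *)
pose n := Num.min 1 (e / (2 * W * B1)).
have W0 : 0 < 2 * W * B1 by rewrite mulr_gt0 // mulr_gt0 //; lra.
have n0 : 0 < n by rewrite lt_min ltr01 divr_gt0.
have n1 : n <= 1 by rewrite ge_min lexx.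
have nW : 2 * W * B1 * n <= e.
  by rewrite -ler_pdivlMl // mulrC ge_min lexx orbT.
have K1 : 0 < 1 + K by lra.
(* The correction [L] may be [K] times as large as the approximation error; with this share,
   [Q = P - L] stays within [n] of [G]. *)
have [g [P PE] gG] := cG (n / (1 + K)) (divr_gt0 n0 K1).
have GP z : disc rho z -> cabs (G z - P.[z]) <= n / (1 + K).
  by move=> /gG; rewrite PE.
have [|z zzs|L [sL Lv LK]] := HK (n / (1 + K)) (horner P).
- by rewrite divr_ge0 // ltW.
- have [zD Gz] := zsG z zzs; have := GP z zD.
  by rewrite Gz sub0r cabsN.
pose Q := P - L.
have GQ z : disc rho z -> cabs (G z - Q.[z]) <= n.
  move=> zD; rewrite /Q !hornerE opprB addrA addrAC.
  rewrite (le_trans (cabsD _ _)) // (le_trans (lerD (GP z zD) (LK z zD))) //.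
  by rewrite -{1}[n / _]mul1r -mulrDl mulrC divfK // gt_eqF.
exists (maxn (size P) (size L)) => N N0 sN.
have sQ : (size Q <= N)%N.
  by rewrite (leq_trans _ sN) // (leq_trans (size_polyD _ _)) // size_polyN.
have D0 : disc rho (0 : C) by rewrite /disc cabs0 ltW.
have G0 : cabs (G 0) ^+ 2 <= cabs Q.[0] ^+ 2 + n * B1.
  apply: sqr_le_perturb; rewrite ?cabs_ge0 ?(ltW n0) //.
    have := cabs_dist Q.[0] (G 0); rewrite cabs_sub.
    by have := GQ 0 D0; have := GB 0 D0; lra.
  by have := cabs_dist (G 0) Q.[0]; have := GQ 0 D0; lra.
have QG k : cabs Q.[rho%:C * unity_root R N ^+ k] ^+ 2 <=
    cabs (G (rho%:C * unity_root R N ^+ k)) ^+ 2 + n * B1.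
  set x := rho%:C * _.
  have xD : disc rho x.
    by rewrite /disc cabsM cabs_unity_root mulr1 cabs_real gtr0_norm.
  apply: sqr_le_perturb; rewrite ?cabs_ge0 ?(ltW n0) //.
    by have := GB x xD; lra.
  have := cabs_dist Q.[x] (G x); rewrite cabs_sub.
  by have := GQ x xD; lra.
have jQ := @poly_jensen R Q N rho zs N0 sQ rho0 uzs.
have {}jQ : cabs Q.[0] ^+ 2 * W <=
    N%:R^-1 * \sum_(k < N) cabs Q.[rho%:C * unity_root R N ^+ k] ^+ 2.
  apply: jQ.
    apply/allP => z zzs; rewrite rootE /Q !hornerE Lv // subrr //.
  by apply/allP => z /zsG[].
have N1 : 0 < N%:R :> R by rewrite ltr0n.
have h : N%:R^-1 * \sum_(k < N) cabs Q.[rho%:C * unity_root R N ^+ k] ^+ 2 <=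
    N%:R^-1 * \sum_(k < N) cabs (G (rho%:C * unity_root R N ^+ k)) ^+ 2 + n * B1.
  rewrite ler_pdivrMl // mulrDr mulrA divff ?gt_eqF // mul1r.
  apply: (@le_trans _ _ (\sum_(k < N) (cabs (G (rho%:C * unity_root R N ^+ k)) ^+ 2 + n * B1))).
    by apply: ler_sum => k _; exact: QG.
  by rewrite big_split /= sumr_const card_ord mulr_natl.
have : cabs (G 0) ^+ 2 * W <= (cabs Q.[0] ^+ 2 + n * B1) * W.
  by rewrite ler_wpM2r //; lra.
have : n * B1 <= n * B1 * W by rewrite ler_peMr // mulr_ge0 // ltW.
by lra.
Qed.

End DiscJensen.

(** * Cayley transform and composition with a symbol *)

Section Cayley.
Variable R : realType.
Local Notation C := R[i].

(* Maps the unit disc onto the half-plane [s0 < Re s], and 0 to [s0 + r + i y]. *)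
Definition cayley (s0 r y : R) (z : C) : C :=
  (s0 +i* y) + r%:C * ((1 + z) / (1 - z)).

Definition cayley_inv (s0 r y : R) (s : C) : C :=
  (s - ((s0 + r) +i* y)) / (s - ((s0 - r) +i* y)).

Lemma cayley0 s0 r y : cayley s0 r y 0 = (s0 + r) +i* y.
Proof.
rewrite /cayley addr0 subr0 divr1 mulr1.
by apply/eqP; rewrite eq_complex /= addr0 !eqxx.
Qed.

Lemma cayley_shift s0 r y z : cayley s0 r y z = cayley s0 r 0 z + (0 +i* y).
Proof.
rewrite /cayley addrAC; congr (_ + _).
by apply/eqP; rewrite eq_complex /= addr0 add0r !eqxx.
Qed.

Lemma Re_cayley_gt s0 r y z : 0 < r -> cabs z < 1 -> s0 < complex.Re (cayley s0 r y z).
Proof.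
move=> r0 z1.
have z2 : cabs z ^+ 2 < 1 by rewrite expr_lt1 // cabs_ge0.
suff h : 0 < complex.Re ((1 + z) / (1 - z)).
  rewrite /cayley; move: h; case: (_ / _) => a b /= a0.
  by rewrite mul0r subr0 ltrDl mulr_gt0.
move: z2; rewrite sqr_cabs; case: z z1 => a b z1 /= z2.
have h : 0 < (1 - a) ^+ 2 + (0 - b) ^+ 2.
  rewrite ltr_wpDr ?sqr_ge0 // exprn_gt0 // subr_gt0.
  by apply: le_lt_trans z1; apply: le_trans (Re_le_cabs (a +i* b)); exact: ler_norm.
move: (_ ^+ 2 + _) h => d h.
have -> : (1 + a) * ((1 - a) / d) - (0 + b) * - ((0 - b) / d) = (1 - (a ^+ 2 + b ^+ 2)) / d.
  by field; rewrite gt_eqF.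
by rewrite divr_gt0 // subr_gt0.
Qed.

Lemma cayley_invK s0 r y s : 0 < r -> s0 < complex.Re s ->
  cayley s0 r y (cayley_inv s0 r y s) = s.
Proof.
move=> r0 s0s; rewrite /cayley /cayley_inv.
set p := s - _; set q := s - _.
have q0 : q != 0.
  rewrite eq_complex /=; move: s0s; rewrite /q; case: (s) => a b /= h.
  by rewrite gt_eqF //; lra.
have qp : q - p = r%:C + r%:C.
  by rewrite /q /p; case: (s) => a b; apply/eqP; rewrite eq_complex /=; apply/andP; split; apply/eqP; ring.
have qpD : q + p = 2 * (s - (s0 +i* y)).
  by rewrite /q /p; case: (s) => a b; apply/eqP; rewrite eq_complex /=; apply/andP; split; apply/eqP; ring.
clearbody p q.
have r2 : r%:C + r%:C != 0 :> C by rewrite eq_complex /= gt_eqF // addr_gt0.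
have -> : 1 - p / q = (q - p) / q by rewrite mulrBl divff.
have -> : 1 + p / q = (q + p) / q by rewrite mulrDl divff.
have -> : (q + p) / q / ((q - p) / q) = (q + p) / (r%:C + r%:C).
  by rewrite qp; field; apply/andP; split.
have rC : r%:C != 0 :> C by rewrite eq_complex /= gt_eqF.
have -> : r%:C * ((q + p) / (r%:C + r%:C)) = (q + p) / 2.
  by move: (r%:C) r2 rC => t t2 t0; field.
rewrite qpD.
by rewrite mulrAC divff ?mul1r ?pnatr_eq0 // addrC subrK.
Qed.

(** When Re s and [|Im s - y|] are at most [r], the right side is of order [(Re s - s0) / r]. This
    is how Jensen's inequality comes to count zeros weighted by their real part, as M_Phi does. *)
Lemma sqr_cabs_cayley_inv s0 r y s : 0 < r -> s0 < complex.Re s ->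
  1 - cabs (cayley_inv s0 r y s) ^+ 2 =
  4 * (complex.Re s - s0) * r / ((complex.Re s - s0 + r) ^+ 2 + (complex.Im s - y) ^+ 2).
Proof.
move=> r0; rewrite /cayley_inv cabsM cabsV exprMn exprVn !sqr_cabs.
case: s => a b /= h.
have -> : a - (s0 - r) = a - s0 + r by ring.
have h2 : 0 < (a - s0 + r) ^+ 2 + (b - y) ^+ 2.
  by rewrite ltr_wpDr ?sqr_ge0 // exprn_gt0 // addr_gt0 // subr_gt0.
by field; rewrite gt_eqF.
Qed.

Lemma uclos_cayley (rho s0 r y : R) : rho < 1 ->
  uclos (disc rho) (@is_poly R) (cayley s0 r y).
Proof.
move=> rho1; have AD := poly_bounded_algebra (R := R) rho.
have cid : uclos (disc rho) (@is_poly R) id.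
  by apply: (uclos_sub); exists 'X => z; rewrite hornerX.
apply: (uclos_add AD); first exact: (uclos_cst AD).
apply: (uclos_mul AD); first exact: (uclos_cst AD).
apply: (uclos_mul AD); first by apply: (uclos_add AD) => //; exact: (uclos_cst AD).
apply: (uclos_inv AD (m := 1 - rho)); first by rewrite subr_gt0.
  move=> z zD; have := Re_le_cabs z; case: z zD => a b zD /= h.
  by rewrite lerD2l lerN2 (le_trans (ler_norm _)) // (le_trans h).
apply: (uclos_add AD); first exact: (uclos_cst AD).
apply: (@uclos_eq _ _ _ _ (fun z => (-1) * z)); first by move=> z _; rewrite mulN1r.
by apply: (uclos_mul AD) => //; exact: (uclos_cst AD).
Qed.

Lemma uclos_npow (X : Type) (D : X -> Prop) (A : (X -> C) -> Prop) n (f : X -> C) :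
  bounded_algebra D A -> uclos D A f -> uclos D A (fun x => npow n (f x)).
Proof.
move=> AD cf.
apply: (@uclos_eq _ _ _ _ (fun x => cexp (- (ln n%:R)%:C * f x))).
  by move=> x _; rewrite npowE.
by apply: (uclos_cexp AD); apply: (uclos_mul AD) => //; exact: (uclos_cst AD).
Qed.

Section Composition.
Variables (c : nat -> C) (Phi : C -> C).
Hypothesis G0 : in_G0 c Phi.
Variables (X : Type) (D : X -> Prop) (A : (X -> C) -> Prop).
Hypothesis AD : bounded_algebra D A.
Variables (s : X -> C) (eps : R).
Hypotheses (eps0 : 0 < eps) (seps : forall x, D x -> eps < complex.Re (s x)).
(** The instances of [s] are the identity on a half-plane and a Cayley map on a disc. Only the
    powers of [s] are asked to be approximable, since on a half-plane [s] itself is unbounded and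
    hence no uniform limit of Dirichlet polynomials. *)
Hypothesis snpow : forall n, uclos D A (fun x => npow n.+1 (s x)).

Lemma uclos_dpoly (q : nat -> C) N :
  uclos D A (fun x => \sum_(k < N) q k * npow k.+1 (s x)).
Proof.
apply: (uclos_sum AD N (f := fun k x => q k * npow k.+1 (s x))) => k.
by apply: (uclos_mul AD) => //; exact: (uclos_cst AD).
Qed.

Lemma uclos_G0 : uclos D A (fun x => Phi (s x)).
Proof.
apply: uclos_lim => e e0; have [N HN] := G0.1 eps eps0 e e0.
exists (fun x => dpart c (s x) N) => [|x /seps h]; first exact: uclos_dpoly.
by rewrite cabs_sub ltW // HN.
Qed.

Lemma uclos_dpoly_G0 (q : nat -> C) N :
  uclos D A (fun x => 1 + \sum_(k < N) q k * npow k.+1 (Phi (s x))).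
Proof.
apply: (uclos_add AD); first exact: (uclos_cst AD).
apply: (uclos_sum AD N (f := fun k x => q k * npow k.+1 (Phi (s x)))) => k.
apply: (uclos_mul AD); first exact: (uclos_cst AD).
exact: uclos_npow uclos_G0.
Qed.

(** The conformal map of Re u > 1/2 onto the unit disc that sends [w] to 0; its pole is the mirror
    image of [w] in the line Re u = 1/2. *)
Definition moebius (w u : C) : C := (u - w) / (u + (w^* - 1)).

Lemma uclos_moebius_G0 w : 1 / 2 < complex.Re w ->
  uclos D A (fun x => moebius w (Phi (s x))).
Proof.
move=> hw; apply: (uclos_mul AD).
  by apply: (uclos_add AD uclos_G0); exact: (uclos_cst AD).
apply: (uclos_inv AD (m := complex.Re w - 1 / 2)); first by rewrite subr_gt0.
  move=> x /seps h; have := G0.2 (s x) (lt_trans eps0 h).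
  by case: (Phi (s x)) => a b; case: (w) => p q /=; lra.
by apply: (uclos_add AD uclos_G0); exact: (uclos_cst AD).
Qed.

End Composition.

End Cayley.

(** * Mean values of Dirichlet series *)

Section DirichletPolynomials.
Variable R : realType.
Local Notation C := R[i].
Implicit Types (q : nat -> C) (s : C).

Definition dsum q N s : C := \sum_(k < N) q k * npow k.+1 s.

Definition rhalf (x0 : R) (s : C) : Prop := x0 < complex.Re s.

Definition is_dpoly (f : C -> C) : Prop :=
  exists N q, (forall k, (N <= k)%N -> q k = 0) /\ f =1 dsum q N.

Lemma dsum_widen q N M s : (N <= M)%N -> (forall k, (N <= k)%N -> q k = 0) ->
  dsum q N s = dsum q M s.
Proof.
move=> NM q0; rewrite /dsum (big_ord_widen M (fun k => q k * npow k.+1 s) NM).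
rewrite big_mkcond; apply: eq_bigr => k _; case: ltnP => // /q0 ->.
by rewrite mul0r.
Qed.

Lemma dsumD q q' N s : dsum (fun k => q k + q' k) N s = dsum q N s + dsum q' N s.
Proof. by rewrite -big_split; apply: eq_bigr => k _; rewrite mulrDl. Qed.

Lemma dsumB q q' N s : dsum (fun k => q k - q' k) N s = dsum q N s - dsum q' N s.
Proof. by rewrite -sumrB; apply: eq_bigr => k _; rewrite mulrBl. Qed.

Lemma is_dpoly_ext f g : f =1 g -> is_dpoly f -> is_dpoly g.
Proof. by move=> fg [N [q [q0 fq]]]; exists N, q; split=> // s; rewrite -fg. Qed.

Lemma is_dpolyD f g : is_dpoly f -> is_dpoly g -> is_dpoly (fun s => f s + g s).
Proof.
move=> [N [q [q0 fq]]] [M [p [p0 gp]]].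
exists (maxn N M), (fun k => q k + p k); split=> [k|s].
  by rewrite geq_max => /andP[Nk Mk]; rewrite q0 // p0 // addr0.
by rewrite dsumD fq gp (dsum_widen _ (leq_maxl N M) q0) (dsum_widen _ (leq_maxr N M) p0).
Qed.

Lemma is_dpoly_term a m : is_dpoly (fun s => a * npow m.+1 s).
Proof.
exists m.+1, (fun k => if k == m then a else 0); split=> [k|s].
  by case: eqP => // ->; rewrite ltnn.
rewrite /dsum (bigD1 ord_max) //= eqxx big1 ?addr0 // => k.
by rewrite -val_eqE /= => /negbTE ->; rewrite mul0r.
Qed.

Lemma is_dpoly_sum n (f : nat -> C -> C) : (forall k, is_dpoly (f k)) ->
  is_dpoly (fun s => \sum_(k < n) f k s).
Proof.
move=> fk; elim: n => [|n IH].
  apply: is_dpoly_ext (is_dpoly_term 0 0) => s.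
  by rewrite big_ord0 mul0r.
by apply: is_dpoly_ext (is_dpolyD IH (fk n)) => s; rewrite big_ord_recr.
Qed.

Lemma is_dpolyM f g : is_dpoly f -> is_dpoly g -> is_dpoly (fun s => f s * g s).
Proof.
move=> [N [q [q0 fq]]] [M [p [p0 gp]]].
have h k : is_dpoly (fun s => \sum_(l < M) (q k * npow k.+1 s) * (p l * npow l.+1 s)).
  apply: (@is_dpoly_sum M (fun l s => (q k * npow k.+1 s) * (p l * npow l.+1 s))) => l.
  apply: is_dpoly_ext (is_dpoly_term (q k * p l) ((k.+1 * l.+1).-1)) => s.
  by rewrite prednK ?muln_gt0 // npowM //; ring.
apply: is_dpoly_ext (is_dpoly_sum N h) => s.
rewrite fq gp /dsum mulr_suml; apply: eq_bigr => k _.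
by rewrite mulr_sumr.
Qed.

Lemma dpoly_bounded_algebra x0 : 0 <= x0 -> bounded_algebra (rhalf x0) is_dpoly.
Proof.
move=> x00; split.
- move=> c; apply: is_dpoly_ext (is_dpoly_term c 0) => s.
  by rewrite npow1 mulr1.
- exact: is_dpolyD.
- exact: is_dpolyM.
- move=> f [N [q [q0 fq]]]; exists (\sum_(k < N) cabs (q k)) => s hs.
  rewrite fq (le_trans (cabs_sum _ _ _)) //; apply: ler_sum => k _.
  rewrite cabsM ler_piMr ?cabs_ge0 // cabs_npow_le1 //.
  exact: le_trans x00 (ltW hs).
Qed.

Lemma geometric_sum_le (u : C) L : cabs u = 1 -> u != 1 ->
  cabs (\sum_(j < L) u ^+ j) <= 2 / cabs (u - 1).
Proof.
move=> u1 un1; rewrite ler_pdivlMr ?cabs_gt0 ?subr_eq0 // mulrC -cabsM -subrX1.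
rewrite (le_trans (cabsB _ _)) // cabsX u1 expr1n cabs1; lra.
Qed.

Lemma cabs_npow_Re m s : cabs (npow m s) = cabs (npow m (complex.Re s)%:C).
Proof. by rewrite !cabs_npow. Qed.

(** Sampling with step [h] causes no aliasing among the first [N] frequencies: the phase difference
    [t] satisfies [0 < |t| < 2], and the sine does not vanish there. *)
Lemma npow_im_neq k l N (h : R) : (k < N)%N -> (l < N)%N -> k != l ->
  0 < h -> h * ln N%:R <= 1 ->
  npow k.+1 (0 +i* h) * (npow l.+1 (0 +i* h))^* != 1.
Proof.
move=> kN lN kl h0 hN.
have N0 : (0 < N)%N by apply: leq_ltn_trans kN.
rewrite conj_npow !npowE -cexpD.
pose t : R := h * (ln l.+1%:R - ln k.+1%:R).
have -> : - (ln k.+1%:R)%:C * (0 +i* h) + - (ln l.+1%:R)%:C * (0 +i* h)^* = 0 +i* t :> C.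
  by apply/eqP; rewrite eq_complex /= /t; apply/andP; split; apply/eqP; ring.
have ts : 0 < `|t| < 2.
  rewrite normrM (gtr0_norm h0); apply/andP; split.
    rewrite mulr_gt0 // normr_gt0 subr_eq0; apply: contra kl => /eqP e.
    have : l.+1%:R = k.+1%:R :> R by apply: (@ln_inj R) => //; rewrite posrE ltr0n.
    by move/eqP; rewrite eqr_nat eqSS eq_sym.
  apply: (@le_lt_trans _ _ 1); last by rewrite ltr1n.
  apply: le_trans hN; rewrite ler_pM2l //.
  have ln0 i : 0 <= ln (i.+1%:R : R) := ln_nat_ge0 R i.
  have lnN i : (i < N)%N -> ln (i.+1%:R : R) <= ln N%:R.
    by move=> iN; rewrite ler_ln ?posrE ?ltr0n // ler_nat.
  by rewrite ler_norml; have := ln0 k; have := ln0 l; have := lnN _ kN; have := lnN _ lN; lra.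
apply/eqP => /(congr1 (@complex.Im R)) /=; rewrite expR0 mul1r => st.
have := sin2_gt0 ts; case: (ger0P t) => _; rewrite ?sinN st ?oppr0 ltxx //.
Qed.

Lemma mulrn_im (h : R) j : (0 +i* h) *+ j = 0 +i* (h * j%:R) :> C.
Proof.
elim: j => [|j IH]; first by rewrite mulr0.
rewrite mulrS IH; apply/eqP; rewrite eq_complex /= addr0 eqxx /=.
by rewrite -natr1; apply/eqP; ring.
Qed.

(* The off-diagonal terms of [|dsum q N|^2] are bounded geometric sums in j. *)
Lemma dsum_mean_square q N (h e : R) : 0 < h -> h * ln N%:R <= 1 -> 0 < e ->
  exists L0, forall L, (0 < L)%N -> (L0 <= L)%N -> forall s, 0 <= complex.Re s ->
  `| L%:R^-1 * (\sum_(j < L) cabs (dsum q N (s + (0 +i* (h * j%:R)))) ^+ 2) -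
     \sum_(k < N) cabs (q k) ^+ 2 * cabs (npow k.+1 s) ^+ 2 | <= e.
Proof.
move=> h0 hN e0.
pose u k l : C := npow k.+1 (0 +i* h) * (npow l.+1 (0 +i* h))^*.
(* Bounds all off-diagonal sums at once, using [|npow| <= 1] on Re s >= 0, so that [L0] is the same
   for all [s]. *)
pose K : R := \sum_(k < N) \sum_(l < N) cabs (q k) * cabs (q l) * (2 / cabs (u k l - 1)).
exists (Num.trunc (K / e)).+1 => L L0 HL s s0.
have L1 : 0 < L%:R :> R by rewrite ltr0n.
pose a k l : C := (q k * npow k.+1 s) * (q l * npow l.+1 s)^*.
have npowj k j : npow k.+1 (s + (0 +i* (h * j%:R))) = npow k.+1 s * npow k.+1 (0 +i* h) ^+ j.
  rewrite npowD; congr (_ * _); rewrite !npowE -cexp_mulrn -mulrnAr.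
  by rewrite mulrn_im.
have sqE j : (cabs (dsum q N (s + (0 +i* (h * j%:R)))) ^+ 2)%:C =
    \sum_(k < N) \sum_(l < N) a k l * u k l ^+ j.
  rewrite sqr_cabsC /dsum rmorph_sum mulr_suml /=; apply: eq_bigr => k _.
  rewrite mulr_sumr; apply: eq_bigr => l _.
  rewrite !npowj !rmorphM /= rmorphXn /= /a /u rmorphM exprMn /=; ring.
have cu k l : cabs (u k l) = 1.
  by rewrite /u cabsM cabs_conj !cabs_npow /= oppr0 !mul0r expR0 mulr1.
have ca (k l : 'I_N) : cabs (a k l) <= cabs (q k) * cabs (q l).
  rewrite /a cabsM cabs_conj !cabsM; apply: ler_pM; rewrite ?mulr_ge0 ?cabs_ge0 //.
    by rewrite ler_piMr ?cabs_ge0 ?cabs_npow_le1.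
  by rewrite ler_piMr ?cabs_ge0 ?cabs_npow_le1.
have ukk k : u k k = 1 by rewrite /u -sqr_cabsC cabs_npow /= oppr0 mul0r expR0 expr1n.
have akk k : a k k = (cabs (q k) ^+ 2 * cabs (npow k.+1 s) ^+ 2)%:C.
  by rewrite /a -sqr_cabsC cabsM exprMn.
rewrite -cabs_real rmorphB rmorphM /= !rmorph_sum /=.
under eq_bigr do rewrite sqE.
rewrite exchange_big /=; under eq_bigr => k _.
  rewrite exchange_big /=; under eq_bigr do rewrite -mulr_sumr.
  over.
under [X in _ - X]eq_bigr do rewrite -akk.
rewrite mulr_sumr -sumrB.
apply: (@le_trans _ _ (L%:R^-1 * K)); last first.
  rewrite ler_pdivrMl // -ler_pdivrMr //; apply: ltW.
  apply: lt_le_trans (truncnS_gt _) _; by rewrite ler_nat.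
rewrite (le_trans (cabs_sum _ _ _)) // /K mulr_sumr; apply: ler_sum => k _.
rewrite (bigD1 k) //= ukk; under [X in a k k * X]eq_bigr do rewrite expr1n.
rewrite sumr_const card_ord mulrDr.
have LC : (L%:R^-1)%:C * L%:R = 1 :> C.
  by rewrite -(rmorph_nat (real_complex R) L) -rmorphM /= mulVf ?gt_eqF.
rewrite mulrCA LC mulr1 addrAC subrr add0r cabsM cabs_real ger0_norm ?invr_ge0 ?(ltW L1) //.
rewrite ler_wpM2l ?invr_ge0 ?(ltW L1) // (le_trans (cabs_sum _ _ _)) //.
rewrite [leRHS](bigD1 k) //= -[leLHS]add0r lerD //.
  by rewrite mulr_ge0 ?mulr_ge0 ?cabs_ge0 // invr_ge0 cabs_ge0.
apply: ler_sum => l lk; rewrite cabsM; apply: ler_pM; rewrite ?cabs_ge0 //.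
by apply: geometric_sum_le => //; apply: (npow_im_neq (N := N)) => //; rewrite eq_sym.
Qed.

Lemma mean_step_exists N : exists2 h : R, 0 < h <= 1 & h * ln N%:R <= 1.
Proof.
have h1 : 1 <= 1 + `|ln N%:R : R| by rewrite lerDl.
have h0 : 0 < 1 + `|ln N%:R : R| by apply: lt_le_trans h1.
exists (1 + `|ln N%:R|)^-1; first by rewrite invr_gt0 h0 invf_le1.
by rewrite mulrC ler_pdivrMr // mul1r (le_trans (ler_norm _)) // lerDr.
Qed.

Lemma mean_le (L : nat) (f : nat -> R) (B : R) : (0 < L)%N ->
  (forall j, f j <= B) -> L%:R^-1 * \sum_(j < L) f j <= B.
Proof.
move=> L0 fB; rewrite ler_pdivrMl ?ltr0n //.
apply: (le_trans (ler_sum _ (fun (j : 'I_L) _ => fB j))).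
by rewrite sumr_const card_ord mulr_natl.
Qed.

Lemma Re_add_im (s : C) (t : R) : complex.Re (s + (0 +i* t)) = complex.Re s.
Proof. by case: s => a b /=; rewrite addr0. Qed.

(** The left side is the limit of averages of [|dsum q N|^2] along the line Re s = [x], each of
    which is at most [e ^+ 2]. This is how uniform closeness becomes closeness of coefficients. *)
Lemma dsum_bessel q N (x e : R) : 0 <= x -> 0 <= e ->
  (forall s, complex.Re s = x -> cabs (dsum q N s) <= e) ->
  \sum_(k < N) cabs (q k) ^+ 2 * cabs (npow k.+1 x%:C) ^+ 2 <= e ^+ 2.
Proof.
move=> x0 e0 qe; apply/ler_addgt0Pr => d d0.
have [h /andP[h0 _] hN] := mean_step_exists N.
have [L0 /(_ L0.+1 isT (leqnSn L0) x%:C x0)] := dsum_mean_square q h0 hN d0.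
rewrite ler_norml lerBrDl lerBlDr => /andP[+ _].
move=> /le_trans; apply; rewrite lerD2r.
suff : L0.+1%:R^-1 * (\sum_(j < L0.+1)
    cabs (dsum q N (x%:C + (0 +i* (h * j%:R)))) ^+ 2) <= e ^+ 2 by [].
apply: (mean_le (f := fun j => cabs (dsum q N (x%:C + (0 +i* (h * j%:R)))) ^+ 2)) => // j.
by rewrite lerXn2r ?nnegrE ?cabs_ge0 // qe // Re_add_im.
Qed.

Lemma inv_sqr_telescope_le N M : (N <= M)%N ->
  \sum_(N.+1 <= k < M.+1) (k.+1%:R ^- 2 : R) <= N.+1%:R^-1 - M.+1%:R^-1.
Proof.
move=> NM; rewrite -(subnKC NM); elim: (M - N)%N => [|d IH].
  by rewrite addn0 big_geq // subrr.
rewrite addnS big_nat_recr /=; last by rewrite ltnS leq_addr.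
apply: (le_trans (lerD IH (lexx _))).
have m0 : 0 < (N + d).+1%:R :> R by rewrite ltr0n.
rewrite -[(N + d).+2%:R]natr1; move: (N + d).+1%:R m0 => m m0.
rewrite -addrA lerD2l addrC lerBlDr.
rewrite -subr_ge0 (_ : _ - _ = (m * (m + 1) ^+ 2)^-1).
  by rewrite invr_ge0 mulr_ge0 ?ltW // exprn_gt0 // addr_gt0.
by field; apply/andP; split; rewrite gt_eqF // addr_gt0.
Qed.

End DirichletPolynomials.

(** * Mean squares of F to the left of the half-plane where its series is given *)

Section MeanSquare.
Variable R : realType.
Local Notation C := R[i].
Variables (F : C -> C) (b : nat -> C) (B x0 : R).
Hypothesis bB : forall N, \sum_(k < N) cabs (b k) ^+ 2 <= B.
Hypothesis bF : forall s, 1 / 2 < complex.Re s -> csum_to (dterm b s) (F s).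
Hypothesis x00 : 0 <= x0.

Lemma coef_le k : cabs (b k) <= 1 + B.
Proof.
have B0 : 0 <= B by have := bB 0; rewrite big_ord0.
have : cabs (b k) ^+ 2 <= B.
  apply: le_trans (bB k.+1); rewrite big_ord_recr /= lerDr.
  by apply: sumr_ge0 => j _; exact: sqr_ge0.
by have := sqr_ge0 (cabs (b k) - 1); have := cabs_ge0 (b k); nra.
Qed.

Lemma cabs_npow_le_inv_sqr k (s : C) : 2 <= complex.Re s ->
  cabs (npow k.+1 s) <= k.+1%:R ^- 2.
Proof.
move=> s2; rewrite cabs_npow.
have -> : k.+1%:R ^- 2 = expR (- 2 * ln k.+1%:R) :> R.
  by rewrite mulNr expRN mulr_natl -[_ *+ 2]mulr_natr expRM_natr lnK // posrE ltr0n.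
by rewrite ler_expR ler_wpM2r ?ln_nat_ge0 // lerN2.
Qed.

Lemma series_tail_le N (s : C) (e : R) : 2 <= complex.Re s -> 0 < e ->
  cabs (F s - dsum b N.+1 s) <= e + (1 + B) / N.+1%:R.
Proof.
move=> s2 e0.
have [|M0 HM0] := bF (s := s) _ e0; first by apply: lt_le_trans s2; lra.
pose M := maxn M0 N.+1.
have h1 : cabs (F s - dsum b M s) < e by rewrite cabs_sub; exact: HM0 (leq_maxl _ _).
have NM : (N.+1 <= M)%N by exact: leq_maxr.
have -> : F s - dsum b N.+1 s = (F s - dsum b M s) + (dsum b M s - dsum b N.+1 s) by ring.
rewrite (le_trans (cabsD _ _)) // lerD ?(ltW h1) //.
rewrite /dsum -!(big_mkord predT (fun k => b k * npow k.+1 s)).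
rewrite (big_cat_nat _ NM) //= addrAC subrr add0r.
rewrite (le_trans (cabs_sum _ _ _)) //.
have B0 : 0 <= 1 + B by apply: le_trans (coef_le 0); exact: cabs_ge0.
apply: (@le_trans _ _ (\sum_(N.+1 <= k < M) (1 + B) * k.+1%:R ^- 2)).
  apply: ler_sum => k _; rewrite cabsM.
  by apply: ler_pM; rewrite ?cabs_ge0 ?coef_le ?cabs_npow_le_inv_sqr.
rewrite -mulr_sumr ler_wpM2l //.
case: M NM {h1 HM0} => // M NM; rewrite ltnS in NM.
by apply: (le_trans (inv_sqr_telescope_le R NM)); rewrite gerBl invr_ge0.
Qed.

(** On the line Re s = [x0 + 2] the approximant and a long partial sum of the series are both close
    to [F], and [dsum_bessel] applies to their difference. The price of moving so far right is the
    weight [npow], which decays with [k]. *)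
Lemma coef_close q N (e : R) : 0 < e -> (forall k, (N <= k)%N -> q k = 0) ->
  (forall s, rhalf x0 s -> cabs (F s - dsum q N s) <= e) ->
  forall k, cabs (q k - b k) * cabs (npow k.+1 (x0 + 2)%:C) <= 3 * e.
Proof.
move=> e0 q0 Fq k.
have B0 : 0 <= 1 + B by apply: le_trans (coef_le 0); exact: cabs_ge0.
(* With a tail of at most [e], the partial sum is within [2 e] of [F] and the approximant within
   [e], whence [3 * e]. *)
have [N1 [NN1 kN1 tail]] : exists N1, [/\ (N <= N1.+1)%N, (k < N1.+1)%N &
    (1 + B) / N1.+1%:R <= e].
  exists (maxn (Num.trunc ((1 + B) / e)) (maxn N k)); split; [lia|lia|].
  rewrite ler_pdivrMr ?ltr0n // mulrC -ler_pdivrMr //; apply: ltW.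
  by apply: lt_le_trans (truncnS_gt _) _; rewrite ler_nat ltnS leq_maxl.
have : \sum_(j < N1.+1) cabs (q j - b j) ^+ 2 * cabs (npow j.+1 (x0 + 2)%:C) ^+ 2
    <= (3 * e) ^+ 2.
  apply: (@dsum_bessel R (fun k => q k - b k)) => [||s sx]; [by rewrite addr_ge0 | by rewrite mulr_ge0 // ltW |].
  rewrite dsumB -(dsum_widen s NN1 q0).
  have -> : dsum q N s - dsum b N1.+1 s = (F s - dsum b N1.+1 s) - (F s - dsum q N s) by ring.
  rewrite (le_trans (cabsB _ _)) //.
  have h1 : cabs (F s - dsum q N s) <= e by apply: Fq; rewrite /rhalf sx; lra.
  have h2 := @series_tail_le N1 s e _ e0.
  have {}h2 : cabs (F s - dsum b N1.+1 s) <= e + e.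
    by apply: le_trans (h2 _) (lerD (lexx e) tail); rewrite sx lerDr.
  by move: h1 h2; clear; lra.
rewrite (bigD1 (Ordinal kN1)) //= => h.
rewrite -(@ler_pXn2r _ 2) ?nnegrE ?mulr_ge0 ?cabs_ge0 ?(ltW e0) //.
rewrite exprMn; apply: le_trans h; rewrite lerDl.
by apply: sumr_ge0 => j _; rewrite -exprMn sqr_ge0.
Qed.

Hypothesis cF : uclos (rhalf x0) (@is_dpoly R) F.

(** The decaying weights of [coef_close] are undone by a second, much finer approximant [p]. Its
    precision [e'] is chosen after [N], so the weights of the first [N] coefficients are harmless
    for [p - b], while [q - p] is uniformly small and falls under [dsum_bessel] on Re s = [y]. *)
Lemma coef_mean_square_close q N (e y : R) : 0 < e -> (forall k, (N <= k)%N -> q k = 0) ->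
  (forall s, rhalf x0 s -> cabs (F s - dsum q N s) <= e) -> x0 < y ->
  \sum_(k < N) cabs (q k - b k) ^+ 2 * cabs (npow k.+1 y%:C) ^+ 2 <= 9 * e ^+ 2.
Proof.
move=> e0 q0 Fq xy.
pose v k := cabs (npow k.+1 (x0 + 2)%:C : C).
have v0 k : 0 < v k by rewrite /v cabs_npow expR_gt0.
pose S := \sum_(k < N) 9 / v k ^+ 2.
have S0 : 0 <= S.
  by apply: sumr_ge0 => k _; rewrite divr_ge0 // exprn_ge0 // ltW.
(* Ensures [e' <= e] and [2 S e'^2 <= e^2]. The two parts then contribute [2 (2 e)^2] and [e^2], in
   total [9 e^2]. *)
pose e' := Num.min e (e ^+ 2 / (1 + 2 * S) / (1 + e)).
have D0 : 0 < 1 + 2 * S by lra.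
have e'0 : 0 < e'.
  by rewrite lt_min e0 /= divr_gt0 ?divr_gt0 ?exprn_gt0 // addr_gt0.
have e'e : e' <= e by rewrite ge_min lexx.
have e'S : 2 * S * e' ^+ 2 <= e ^+ 2.
  have h : e' * (1 + e) * (1 + 2 * S) <= e ^+ 2.
    rewrite -ler_pdivlMr // -ler_pdivlMr; last by lra.
    by rewrite ge_min lexx orbT.
  apply: le_trans h; have : e' ^+ 2 <= e' * (1 + e) by nra.
  by move/(ler_wpM2r (ltW D0)); have := sqr_ge0 e'; nra.
have [g [M [p [p0 pE]]] Fg] := cF e'0.
have Fp s : rhalf x0 s -> cabs (F s - dsum p M s) <= e' by move=> /Fg; rewrite pE.
have w1 k : cabs (npow k.+1 y%:C : C) <= 1.
  by rewrite cabs_npow_le1 //= (le_trans x00) // ltW.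
have pb k : cabs (p k - b k) ^+ 2 <= 9 / v k ^+ 2 * e' ^+ 2.
  have := coef_close e'0 p0 Fp k; rewrite -/(v k) -ler_pdivlMr ?v0 // => h.
  have -> : 9 / v k ^+ 2 * e' ^+ 2 = (3 * e' / v k) ^+ 2.
    by field; rewrite gt_eqF.
  by rewrite lerXn2r ?nnegrE ?cabs_ge0 // (le_trans _ h) ?cabs_ge0.
have qp : \sum_(k < N) cabs (q k - p k) ^+ 2 * cabs (npow k.+1 y%:C) ^+ 2 <= (2 * e) ^+ 2.
  pose W := maxn N M.
  apply: le_trans (@dsum_bessel R (fun k => q k - p k) W y (2 * e) _ _ _).
  - rewrite (big_ord_widen W (fun k => cabs (q k - p k) ^+ 2 * cabs (npow k.+1 y%:C) ^+ 2)) ?leq_maxl //.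
    rewrite big_mkcond; apply: ler_sum => k _; case: ifP => // _.
    by rewrite -exprMn sqr_ge0.
  - by rewrite (le_trans x00) // ltW.
  - by rewrite mulr_ge0 // ltW.
  - move=> s sy; rewrite dsumB -(dsum_widen s (leq_maxl N M) q0) -(dsum_widen s (leq_maxr N M) p0).
    have -> : dsum q N s - dsum p M s = (F s - dsum p M s) - (F s - dsum q N s) by ring.
    rewrite (le_trans (cabsB _ _)) //.
    have sx : rhalf x0 s by rewrite /rhalf sy.
    by have := Fp s sx; have := Fq s sx; lra.
apply: (@le_trans _ _ (\sum_(k < N) (2 * (cabs (q k - p k) ^+ 2 * cabs (npow k.+1 y%:C) ^+ 2)
   + 2 * (9 / v k ^+ 2 * e' ^+ 2)))).
  apply: ler_sum => k _.
  have -> : q k - b k = (q k - p k) + (p k - b k) by ring.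
  have := sqr_cabsD_le (q k - p k) (p k - b k) (@ltr01 R); rewrite invr1.
  have w01 : 0 <= cabs (npow k.+1 y%:C : C) ^+ 2 <= 1.
    by rewrite sqr_ge0 /= exprn_ile1 ?cabs_ge0 ?w1.
  have := pb k; have := sqr_ge0 (cabs (p k - b k)).
  move: w01 (9 / _ * _) (cabs (p k - b k) ^+ 2) (cabs (q k - p k) ^+ 2).
  move: (cabs (npow _ _) ^+ 2) (cabs (_ + _) ^+ 2); clear => w c w01 z d a d0 dz.
  by have /andP[w0 w1] := w01; nra.
rewrite big_split /= -!mulr_sumr -mulr_suml -/S.
by lra.
Qed.

(** Transfers the bound [B] to the half-plane Re s > [x0]: Young's inequality is used once to pass
    from [F] to an approximant and once from its coefficients to [b], with [dsum_mean_square] in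
    between. The estimate is uniform in [s], as needed for averaging over circles. *)
Lemma mean_square_le (e : R) : 0 < e -> exists2 h : R, 0 < h <= 1 &
  exists L0, forall L, (0 < L)%N -> (L0 <= L)%N -> forall s, rhalf x0 s ->
  L%:R^-1 * (\sum_(j < L) cabs (F (s + (0 +i* (h * j%:R)))) ^+ 2) <= B + e.
Proof.
move=> e0.
have B0 : 0 <= B by have := bB 0; rewrite big_ord0.
(* The errors add up to at most [3 t B + (19 T + 2) d]. As [T = 1 + 1 / t] is large, [t] is fixed
   before [d]; each part gets [e / 2]. *)
pose t := Num.min 1 (e / (6 * (B + 1))).
have t0 : 0 < t by rewrite lt_min ltr01 divr_gt0 // mulr_gt0 //; lra.
have t1 : t <= 1 by rewrite ge_min lexx.
have tB : t * (6 * (B + 1)) <= e.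
  by rewrite -ler_pdivlMr ?ge_min ?lexx ?orbT // mulr_gt0 //; lra.
pose T := 1 + t^-1.
have T1 : 1 <= T by rewrite lerDl invr_ge0 ltW.
pose d := Num.min 1 (e / (2 * (19 * T + 2))).
have d0 : 0 < d by rewrite lt_min ltr01 divr_gt0 // mulr_gt0 //; lra.
have d1 : d <= 1 by rewrite ge_min lexx.
have dT : d * (2 * (19 * T + 2)) <= e.
  by rewrite -ler_pdivlMr ?ge_min ?lexx ?orbT // mulr_gt0 //; lra.
have [g [N [q [q0 qE]]] Fg] := cF d0.
have Fq s : rhalf x0 s -> cabs (F s - dsum q N s) <= d by move=> /Fg; rewrite qE.
have [h /andP[h0 h1] hN] := mean_step_exists R N.
have [L0 HL0] := dsum_mean_square q h0 hN d0.
exists h; first by rewrite h0.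
exists L0 => L L1 LL s sx.
have s0 : 0 <= complex.Re s by rewrite (le_trans x00) // ltW.
have := HL0 L L1 LL s s0; rewrite ler_norml lerBlDr => /andP[_].
set A := _ * _; set D := \sum_(k < N) _ => AD.
have DB : D <= (1 + t) * B + T * (9 * d ^+ 2).
  rewrite /D; under eq_bigr do rewrite cabs_npow_Re.
  apply: (@le_trans _ _ (\sum_(k < N) ((1 + t) * cabs (b k) ^+ 2 +
      T * (cabs (q k - b k) ^+ 2 * cabs (npow k.+1 (complex.Re s)%:C) ^+ 2)))).
    apply: ler_sum => k _.
    have := sqr_cabsD_le (b k) (q k - b k) t0; rewrite addrC subrK -/T.
    have : 0 <= cabs (npow k.+1 (complex.Re s)%:C : C) ^+ 2 <= 1.
      by rewrite sqr_ge0 expr_le1 ?cabs_ge0 // cabs_npow_le1.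
    have : 0 <= (1 + t) * cabs (b k) ^+ 2 by rewrite mulr_ge0 ?sqr_ge0 //; lra.
    rewrite [X in _ -> _ -> _ -> _ <= _ + X]mulrA.
    move: (T * cabs (q k - b k) ^+ 2) ((1 + t) * cabs (b k) ^+ 2).
    move: (cabs (npow _ _) ^+ 2) (cabs (q k) ^+ 2).
    by clear => w1 g1 a1 c1 k2 /andP[k3 k4] k5; nra.
  have T0 : 0 <= T by apply: le_trans T1.
  by rewrite big_split /= -!mulr_sumr lerD // ler_wpM2l ?coef_mean_square_close ?bB // addr_ge0 // ltW.
apply: (@le_trans _ _ ((1 + t) * A + T * d ^+ 2)).
  rewrite ler_pdivrMl ?ltr0n // /A.
  have -> : L%:R * ((1 + t) * (L%:R^-1 * \sum_(j < L) cabs (dsum q N (s + (0 +i* (h * j%:R)))) ^+ 2) +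
     T * d ^+ 2) = \sum_(j < L) ((1 + t) * cabs (dsum q N (s + (0 +i* (h * j%:R)))) ^+ 2 + T * d ^+ 2).
    rewrite big_split /= -mulr_sumr sumr_const card_ord -mulr_natl.
    by field; rewrite pnatr_eq0 -lt0n.
  apply: ler_sum => j _.
  set s' := s + _.
  have s'x : rhalf x0 s' by rewrite /rhalf Re_add_im.
  have := sqr_cabsD_le (dsum q N s') (F s' - dsum q N s') t0.
  rewrite addrC subrK -/T => /le_trans; apply; rewrite lerD2l ler_wpM2l //; first by lra.
  by rewrite lerXn2r ?nnegrE ?cabs_ge0 ?(ltW d0) ?Fq.
have T0 : 0 <= T by lra.
have dd : d ^+ 2 <= d by nra.
have h2 : T * d ^+ 2 <= T * d by rewrite ler_wpM2l.
have h3 : (1 + t) * A <= (1 + t) * (d + ((1 + t) * B + T * (9 * d ^+ 2))).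
  by rewrite ler_wpM2l //; lra.
have h4 : t * (t * B) <= t * B by rewrite ler_piMl // mulr_ge0 // ltW.
have h5 : t * (T * d ^+ 2) <= T * d ^+ 2 by rewrite ler_piMl // mulr_ge0 // sqr_ge0.
have h6 : t * d <= d by rewrite ler_piMl // ltW.
by lra.
Qed.

End MeanSquare.

(** * Counting zeros in the mean *)

Section Counting.
Variable R : realType.
Local Notation C := R[i].

Lemma sumr_ge0_seq (I : eqType) (s : seq I) (P : pred I) (f : I -> R) :
  (forall i, i \in s -> P i -> 0 <= f i) -> 0 <= \sum_(i <- s | P i) f i.
Proof. by move=> h; rewrite big_seq_cond; apply: sumr_ge0 => i /andP[]; exact: h. Qed.

Lemma finite_eventually (P : nat -> nat -> Prop) :
  (forall k, exists n0, forall n, (n0 <= n)%N -> P k n) ->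
  forall L, exists n0, forall n, (n0 <= n)%N -> forall k, (k < L)%N -> P k n.
Proof.
move=> h; elim=> [|L [n0 IH]]; first by exists 0.
have [n1 h1] := h L; exists (maxn n0 n1) => n; rewrite geq_max => /andP[n0n n1n] k.
by rewrite ltnS leq_eqVlt => /predU1P[->|]; [exact: h1 | exact: IH].
Qed.

(** A window of length [2 r] holds about [2 r / h] grid points. Claiming only [r / h] absorbs the
    rounding at both ends, as [h <= 1 <= r]. *)
Lemma count_grid_ge (h r A M : R) : 0 < h -> h <= 1 -> 1 <= r -> 0 <= A -> A + 2 * r <= M ->
  r / h <= \sum_(k < (Num.trunc (M / h)).+1) ((A <= h * k%:R <= A + 2 * r)%R)%:R.
Proof.
move=> h0 h1 r1 A0 AM; have r0 : 0 <= r by lra.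
have Ah0 : 0 <= A / h by rewrite divr_ge0 // ltW.
have rh0 : 0 <= r / h by rewrite divr_ge0 // ltW.
pose k0 := (Num.trunc (A / h)).+1; pose m := (Num.trunc (r / h)).+1.
have k0A : A < h * k0%:R by rewrite -ltr_pdivrMl // [ltLHS]mulrC truncnS_gt.
have k0A1 : h * k0%:R <= A + h.
  rewrite /k0 -natr1 mulrDr mulr1 lerD2r -ler_pdivlMl // [leRHS]mulrC.
  by rewrite truncn_le.
have mr : r / h < m%:R by rewrite truncnS_gt.
have mr1 : h * m%:R <= r + h.
  rewrite /m -natr1 mulrDr mulr1 lerD2r -ler_pdivlMl // [leRHS]mulrC.
  by rewrite truncn_le.
pose L := (Num.trunc (M / h)).+1.
have k0mL : (k0 + m <= L)%N.
  rewrite /L /m addnS ltnS truncn_ge_nat; last first.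
    by rewrite divr_ge0 ?ltW //; lra.
  rewrite ler_pdivlMr // natrD mulrC mulrDr.
  by move: mr1; rewrite /m -natr1 mulrDr mulr1; lra.
apply: (le_trans (ltW mr)).
rewrite -/L -(big_mkord predT (fun k => ((A <= h * k%:R <= A + 2 * r)%R)%:R : R)).
rewrite (big_cat_nat (leq0n k0)) /=; last by rewrite (leq_trans _ k0mL) // leq_addr.
rewrite (big_cat_nat (leq_addr m k0)) //=.
have -> : \sum_(k0 <= k < k0 + m) ((A <= h * k%:R <= A + 2 * r)%R)%:R = m%:R :> R.
  rewrite big_nat (eq_bigr (fun=> 1)) => [|k /andP[k0k km]].
    by rewrite -big_nat sumr_const_nat addKn.
  have a1 : h * k0%:R <= h * k%:R by rewrite ler_pM2l // ler_nat.
  have a2 : h * k%:R <= h * (k0%:R + m%:R - 1).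
    rewrite ler_pM2l // lerBrDr natr1 -natrD ler_nat //.
  have -> // : A <= h * k%:R <= A + 2 * r.
  apply/andP; split; first by lra.
  by apply: (le_trans a2); move: k0A1 mr1; rewrite mulrBr mulrDr; lra.
have ge0 (i j : nat) : 0 <= \sum_(i <= k < j) ((A <= h * k%:R <= A + 2 * r)%R)%:R :> R.
  by apply: sumr_ge0.
by rewrite -[leLHS]add0r lerD // -[leLHS]addr0 lerD.
Qed.

Variables (F : C -> C) (Finf : C) (B s0 : R).
Hypothesis s00 : 0 < s0.
Hypothesis B0 : 0 <= B.
Hypothesis Finf0 : Finf != 0.
Hypothesis Flim : forall e : R, 0 < e -> exists x1 : R, forall s : C,
  x1 <= complex.Re s -> cabs (F s - Finf) <= e.
Hypothesis Fcay : forall rho r y : R, 0 < rho -> rho < 1 -> 0 < r ->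
  uclos (disc rho) (@is_poly R) (fun z => F (cayley s0 r y z)).
Hypothesis Fmean : forall e : R, 0 < e -> exists2 h : R, 0 < h <= 1 &
  exists L0, forall L, (0 < L)%N -> (L0 <= L)%N -> forall s, rhalf s0 s ->
  L%:R^-1 * (\sum_(j < L) cabs (F (s + (0 +i* (h * j%:R)))) ^+ 2) <= B + e.

(** For a zero with Re s <= [r] and [|Im s - y| <= r], the denominator in [sqr_cabs_cayley_inv] is
    at most [(2 r)^2 + r^2 = 5 r^2], and Re s > [2 s0] gives [4 (Re s - s0) >= Re s + 2 s0]. The
    surplus [2 s0 / (5 r)] is exactly [1 - rho ^+ 2], so shrinking the disc to radius [rho] still
    leaves the weight [Re s / (5 r)]. *)
Lemma jensen_at (r y rho e2 : R) (X : seq C) : 1 <= r -> 2 * s0 <= r -> 0 < e2 -> uniq X ->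
  0 < rho -> rho < 1 -> rho ^+ 2 = 1 - 2 * s0 / (5 * r) ->
  (forall s, s \in X -> [/\ F s = 0, 2 * s0 < complex.Re s & complex.Re s <= r]) ->
  exists N0 : nat, forall N, (N0 <= N)%N -> (0 < N)%N ->
    cabs (F ((s0 + r) +i* y)) ^+ 2 *
      (1 + \sum_(s <- X | `|complex.Im s - y| <= r) complex.Re s / (5 * r)) <=
    N%:R^-1 * \sum_(j < N) cabs (F (cayley s0 r y (rho%:C * unity_root R N ^+ j))) ^+ 2 + e2.
Proof.
move=> r1 s0r e20 uX rho0 rho1 rhoE XF; have r0 : 0 < r by apply: lt_le_trans r1.
pose Y := [seq s <- X | `|complex.Im s - y| <= r].
have YF s : s \in Y -> [/\ F s = 0, 2 * s0 < complex.Re s, complex.Re s <= r &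
    `|complex.Im s - y| <= r].
  by rewrite mem_filter => /andP[sy /XF[]].
have Ys0 s : s \in Y -> s0 < complex.Re s by move=> /YF[_ h _ _]; move: s00; lra.
have key s : s \in Y -> complex.Re s / (5 * r) + 2 * s0 / (5 * r) <= 1 - cabs (cayley_inv s0 r y s) ^+ 2.
  move=> sY; rewrite (sqr_cabs_cayley_inv y r0 (Ys0 s sY)).
  have [_ h1 h2] := YF s sY; rewrite -ler_sqr ?nnegrE ?(ltW r0) // real_normK ?num_real //.
  move: (complex.Re s) (complex.Im s - y) h1 h2 => a b h1 h2 h3.
  have D : (a - s0 + r) ^+ 2 + b ^+ 2 <= 5 * r ^+ 2 by move: s00; nra.
  have D0 : 0 < (a - s0 + r) ^+ 2 + b ^+ 2.
    by rewrite ltr_wpDr ?sqr_ge0 // exprn_gt0 //; move: s00; lra.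
  rewrite ler_pdivlMr //.
  apply: (@le_trans _ _ ((a / (5 * r) + 2 * s0 / (5 * r)) * (5 * r ^+ 2))).
    rewrite ler_wpM2l // addr_ge0 // divr_ge0 //; try (by rewrite mulr_ge0 // ltW).
    by move: s00; lra.
  have -> : (a / (5 * r) + 2 * s0 / (5 * r)) * (5 * r ^+ 2) = (a + 2 * s0) * r.
    by field; rewrite gt_eqF.
  by rewrite ler_pM2r //; lra.
pose zs := [seq cayley_inv s0 r y s | s <- Y].
have uz : uniq zs.
  rewrite map_inj_in_uniq ?filter_uniq // => s s' sY s'Y ss'.
  by rewrite -(cayley_invK y r0 (Ys0 s sY)) ss' cayley_invK // Ys0.
have rho20 : 0 < rho ^+ 2 by rewrite exprn_gt0.
have Yr s : s \in Y -> 0 <= complex.Re s / (5 * r).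
  move=> sY; rewrite divr_ge0 ?mulr_ge0 ?(ltW r0) //.
  by apply: ltW; apply: lt_trans s00 (Ys0 s sY).
have key2 s : s \in Y -> complex.Re s / (5 * r) <= 1 - cabs (cayley_inv s0 r y s) ^+ 2 / rho ^+ 2.
  move=> sY; have h := key s sY; have a0 := Yr s sY.
  rewrite lerBrDr -lerBrDl ler_pdivrMr // rhoE.
  have d0 : 0 <= 2 * s0 / (5 * r) by rewrite divr_ge0 // mulr_ge0 // ltW.
  move: (complex.Re s / _) (2 * s0 / _) (cabs _ ^+ 2) h a0 d0 => a d c h a0 d0.
  by nra.
have zG z : z \in zs -> disc rho z /\ F (cayley s0 r y z) = 0.
  move=> /mapP[s sY ->]; rewrite cayley_invK ?Ys0 //; split; last by have [] := YF s sY.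
  rewrite /disc -ler_sqr ?nnegrE ?cabs_ge0 ?(ltW rho0) // rhoE.
  by have := key s sY; have := Yr s sY; lra.
have [N0 HN0] := disc_jensen rho0 (Fcay y rho0 rho1 r0) uz zG e20.
exists N0 => N N0N N1; apply: le_trans (HN0 N N1 N0N); rewrite cayley0.
rewrite ler_wpM2l ?sqr_ge0 // lerD2l big_map -[leLHS]big_filter -/Y.
rewrite [leLHS]big_seq [leRHS]big_seq. by apply: ler_sum => s; exact: key2.
Qed.

Lemma lower_constant (e : R) : 0 < e -> exists2 e2 : R, 0 < e2 < 1 &
  B + 2 * e2 <= cabs Finf ^+ 2 * (1 - e2) * (B / cabs Finf ^+ 2 + e).
Proof.
move=> e0; have f0 : 0 < cabs Finf ^+ 2 by rewrite exprn_gt0 // cabs_gt0.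
move: (cabs Finf ^+ 2) f0 => f f0.
pose a := f * e; have a0 : 0 < a by rewrite mulr_gt0.
have D0 : 0 < 2 + B + a by move: B0; lra.
(* The value of [e2] that turns the required inequality into an equality. *)
exists (a / (2 + B + a)).
  by rewrite divr_gt0 //= ltr_pdivrMr // mul1r; move: B0; lra.
have -> : f * (1 - a / (2 + B + a)) * (B / f + e) = (1 - a / (2 + B + a)) * (B + a).
  by rewrite /a; field; rewrite !gt_eqF.
rewrite -subr_ge0.
have -> : (1 - a / (2 + B + a)) * (B + a) - (B + 2 * (a / (2 + B + a))) = 0.
  by field; rewrite gt_eqF.
by [].
Qed.

Lemma far_lower_bound (e2 : R) : 0 < e2 -> e2 < 1 -> exists x1 : R, forall s,
  x1 <= complex.Re s -> cabs Finf ^+ 2 * (1 - e2) <= cabs (F s) ^+ 2.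
Proof.
move=> e20 e21; have m0 : 0 < cabs Finf by rewrite cabs_gt0.
have [x1 Hx1] := Flim (divr_gt0 (mulr_gt0 m0 e20) (ltr0n _ 2)).
exists x1 => s /Hx1; have := cabs_dist Finf (F s); rewrite cabs_sub.
move: (cabs Finf) (cabs (F s)) (cabs (_ - _)) m0 => m n d m0 h1 h2.
have h3 : m * (1 - e2 / 2) <= n by lra.
have h4 : 0 <= m * (1 - e2 / 2) by rewrite mulr_ge0 ?(ltW m0) //; lra.
have : (m * (1 - e2 / 2)) ^+ 2 <= n ^+ 2.
  by rewrite lerXn2r ?nnegrE // (le_trans h4).
apply: le_trans; rewrite exprMn ler_wpM2l ?sqr_ge0 //.
by have := sqr_ge0 e2; nra.
Qed.

(* Average the disc inequality over the base points [s0 + r + i (h k - T - r)]. *)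
Lemma counting_le (e : R) : 0 < e -> exists T0 : R, forall T, T0 <= T ->
  forall X : seq C, uniq X ->
  (forall s, s \in X -> [/\ F s = 0, `|complex.Im s| < T & 2 * s0 < complex.Re s]) ->
  \sum_(s <- X) complex.Re s <= T * (20 * (B / cabs Finf ^+ 2 - 1) + e).
Proof.
move=> e0.
have [e2 /andP[e20 e21] e2B] := lower_constant (divr_gt0 e0 (ltr0n _ 20)).
have [x1 Hx1] := far_lower_bound e20 e21.
pose f1 := cabs Finf ^+ 2 * (1 - e2).
have f10 : 0 < f1 by rewrite mulr_gt0 ?exprn_gt0 ?cabs_gt0 // subr_gt0.
have [h /andP[h0 h1] [L0 HL0]] := Fmean e20.
(* Beyond [x1], [F] stays close to [Finf]. Hence all zeros in [X] satisfy Re s <= [r], and [|F|] is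
   bounded below at the base points. *)
pose r := `|x1| + 2 * s0 + 1.
have x1r : x1 <= r by have := ler_norm x1; rewrite /r; move: s00; lra.
have r1 : 1 <= r by have := normr_ge0 x1; rewrite /r; move: s00; lra.
have s0r : 2 * s0 <= r by have := normr_ge0 x1; rewrite /r; lra.
clearbody r; have r0 : 0 < r by lra.
pose eta := 2 * s0 / (5 * r).
have eta0 : 0 < eta by rewrite divr_gt0 ?mulr_gt0.
have eta1 : eta <= 1 / 5.
  by rewrite /eta ler_pdivrMr ?mulr_gt0 //; lra.
pose rho := Num.sqrt (1 - eta).
have rho0 : 0 < rho by rewrite sqrtr_gt0; lra.
have rhoE : rho ^+ 2 = 1 - eta by rewrite sqr_sqrtr //; lra.
have rho1 : rho < 1.
  by rewrite -(@ltr_pXn2r _ 2) ?nnegrE ?(ltW rho0) // expr1n rhoE; lra.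
exists (L0%:R + r + 1) => T TT X uX XF.
have L0r : 0 <= L0%:R :> R by [].
(* Enough grid points to cover the window of half-width [r] around every Im s with [|Im s| < T]. *)
pose L := (Num.trunc (2 * (T + r) / h)).+1.
have TL : 2 * (T + r) / h < L%:R by exact: truncnS_gt.
have T0 : 0 < T by lra.
have M0 : 0 <= 2 * (T + r) / h by rewrite divr_ge0 ?(ltW h0) //; lra.
have LT : h * L%:R <= 2 * (T + r) + 1.
  rewrite /L -natr1 mulrDr mulr1 lerD // -ler_pdivlMl // [leRHS]mulrC.
  by rewrite truncn_le.
have L0L : (L0 <= L)%N.
  rewrite -(ler_nat R); apply: le_trans (ltW TL).
  rewrite ler_pdivlMr //; apply: (@le_trans _ _ L0%:R); first by rewrite ler_piMr.
  by lra.
pose y k : R := h * k%:R - (T + r).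
have XFr s : s \in X -> [/\ F s = 0, 2 * s0 < complex.Re s & complex.Re s <= r].
  move=> sX; have [Fs _ ss] := XF s sX; split=> //.
  rewrite leNgt; apply/negP => rs.
  have := Hx1 s (le_trans x1r (ltW rs)); rewrite Fs cabs0 expr0n /= -/f1.
  by rewrite leNgt f10.
(* The threshold in [jensen_at] depends on the base point; a common [N] for all [L] of them is
   needed to exchange the two averages. *)
have [n0 Hn0] := finite_eventually
  (fun k => @jensen_at r (y k) rho e2 X r1 s0r e20 uX rho0 rho1 rhoE XFr) L.
have {}Hn0 := Hn0 n0.+1 (leqnSn n0).
set N := n0.+1 in Hn0.
pose S k := \sum_(s <- X | `|complex.Im s - y k| <= r) complex.Re s / (5 * r).
pose Q k := N%:R^-1 * \sum_(j < N) cabs (F (cayley s0 r (y k) (rho%:C * unity_root R N ^+ j))) ^+ 2.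
have X0 s : s \in X -> 0 <= complex.Re s.
  by move=> /XFr[_ + _]; move: s00; lra.
have step k : (k < L)%N -> f1 * (1 + S k) <= Q k + e2.
  move=> kL; apply: le_trans (Hn0 k kL isT); rewrite ler_wpM2r //.
    rewrite addr_ge0 //; apply: sumr_ge0_seq => s sX _.
    by rewrite divr_ge0 ?X0 // mulr_ge0 // ltW.
  by rewrite Hx1 //= (le_trans x1r) // lerDr ltW.
(* For a fixed root of unity the points on the [L] circles are vertical translates of one point by
   [h k], so [Fmean] applies to the inner sum. *)
have sumQ : \sum_(k < L) Q k <= L%:R * (B + e2).
  rewrite -mulr_sumr exchange_big /= ler_pdivrMl ?ltr0n //.
  have hj (j : 'I_N) : \sum_(k < L) cabs (F (cayley s0 r (y k) (rho%:C * unity_root R N ^+ j))) ^+ 2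
      <= L%:R * (B + e2).
    set z := _ * _.
    have zs : rhalf s0 (cayley s0 r (- (T + r)) z).
      by apply: Re_cayley_gt => //; rewrite cabsM cabs_unity_root mulr1 cabs_real gtr0_norm.
    have := HL0 L isT L0L _ zs; rewrite ler_pdivrMl ?ltr0n // => HL.
    apply: le_trans HL; rewrite le_eqVlt; apply/orP; left; apply/eqP.
    apply: eq_bigr => k _; congr (cabs (F _) ^+ 2).
    rewrite (cayley_shift s0 r (y k)) (cayley_shift s0 r (- (T + r))).
    move: (cayley s0 r 0 z) => p; rewrite -addrA; congr (_ + _).
    by apply/eqP; rewrite eq_complex /= addr0 eqxx /= /y addrC.
  apply: (le_trans (ler_sum _ (fun j _ => hj j))).
  by rewrite sumr_const card_ord [leRHS]mulr_natl.
(* Each zero is seen from at least [r / h] base points, each time with weight [Re s / (5 r)]; the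
   auxiliary scale [r] cancels. *)
have sumS : (\sum_(s <- X) complex.Re s) / (5 * h) <= \sum_(k < L) S k.
  have -> : \sum_(k < L) S k = \sum_(k < L) \sum_(s <- X)
      (if `|complex.Im s - y k| <= r then complex.Re s / (5 * r) else 0).
    by apply: eq_bigr => k _; rewrite /S big_mkcond.
  rewrite exchange_big /= mulr_suml.
  rewrite big_seq [leRHS]big_seq; apply: ler_sum => s sX.
  have [_ sT ss] := XF s sX.
  pose A := complex.Im s + T.
  have A0 : 0 <= A by move: sT; rewrite ltr_norml /A => /andP[? _]; lra.
  have AM : A + 2 * r <= 2 * (T + r).
    by move: sT; rewrite ltr_norml /A => /andP[_ ?]; lra.
  have cnt := count_grid_ge h0 h1 r1 A0 AM.
  have -> : \sum_(k < L) (if `|complex.Im s - y k| <= r then complex.Re s / (5 * r) else 0) =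
     complex.Re s / (5 * r) * \sum_(k < L) ((A <= h * k%:R <= A + 2 * r)%R)%:R.
    rewrite mulr_sumr; apply: eq_bigr => k _.
    have -> : (`|complex.Im s - y k| <= r) = (A <= h * k%:R <= A + 2 * r).
      by rewrite ler_norml /y /A andbC; congr andb; apply/idP/idP; lra.
    by case: ifP => _; rewrite ?mulr1 ?mulr0.
  have -> : complex.Re s / (5 * h) = complex.Re s / (5 * r) * (r / h).
    by field; rewrite !gt_eqF.
  by rewrite ler_wpM2l // divr_ge0 ?X0 // mulr_ge0 // ltW.
have main : f1 * (L%:R + \sum_(k < L) S k) <= L%:R * (B + 2 * e2).
  apply: (@le_trans _ _ (\sum_(k < L) f1 * (1 + S k))).
    by rewrite -mulr_sumr big_split /= sumr_const card_ord.
  apply: (@le_trans _ _ (\sum_(k < L) (Q k + e2))).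
    by apply: ler_sum => k _; exact: step.
  rewrite big_split /= sumr_const card_ord -mulr_natl.
  by move: sumQ; rewrite !mulrDr; lra.
pose G := B / cabs Finf ^+ 2 + e / 20.
pose V := \sum_(s <- X) complex.Re s.
have V0 : 0 <= V by apply: sumr_ge0_seq => s sX _; exact: X0.
have h2 : f1 * (L%:R + V / (5 * h)) <= f1 * (L%:R * G).
  apply: (@le_trans _ _ (f1 * (L%:R + \sum_(k < L) S k))).
    by rewrite ler_pM2l // lerD2l.
  by apply: (le_trans main); rewrite mulrCA ler_wpM2l.
have {h2} h2 : V <= 5 * (h * L%:R) * (G - 1).
  move: h2; rewrite ler_pM2l // => h2.
  have {}h2 : V / (5 * h) <= L%:R * (G - 1) by rewrite mulrBr mulr1; lra.
  by move: h2; rewrite ler_pdivrMr ?mulr_gt0 // => h2; apply: (le_trans h2); rewrite le_eqVlt; apply/orP; left; apply/eqP; ring.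
have hL0 : 0 < 5 * (h * L%:R) by rewrite !mulr_gt0.
have G1 : 0 <= G - 1.
  by rewrite -(pmulr_rge0 _ hL0); exact: le_trans h2.
apply: (le_trans h2).
(* The 20 comes from [5 h L] and [h L <= 2 (T + r) + 1 <= 4 T]. That [G - 1] is nonnegative was read
   off from [0 <= V]. *)
have -> : T * (20 * (B / cabs Finf ^+ 2 - 1) + e) = 20 * T * (G - 1) by rewrite /G; field; rewrite cabs_eq0.
by rewrite ler_wpM2r //; lra.
Qed.

End Counting.

(** * Limits, norms and elementary sums *)

Section Estimates.
Variable R : realType.
Local Notation C := R[i].

(* A divergent [lim] in [\bar R] is 0, so an upper bound by a nonnegative number
   needs no convergence. *)
Lemma lime_le_ge0 (T : Type) (G : set_system T) (PG : ProperFilter G) (f : T -> \bar R) (g : R) :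
  0 <= g -> (forall e : R, 0 < e -> \forall x \near G, (f x <= (g + e)%:E)%E)%classic ->
  (lim (f x @[x --> G])%classic <= g%:E)%E.
Proof.
move=> g0 fg; have [cf|/dvgP ->] := pselect (cvg (f x @[x --> G])%classic).
  apply/lee_addgt0Pr => e e0; rewrite -EFinD.
  by apply: lime_le => //; exact: fg.
by rewrite lee_fin.
Qed.

(** The [\esum] is a supremum over finite subsets, so it suffices to bound sums over duplicate-free
    lists of solutions. *)
Lemma mean_counting_le (Phi : C -> C) (w : C) (g : R) : 0 <= g ->
  (forall sigma e : R, 0 < sigma -> 0 < e -> exists T0 : R, forall T, T0 <= T ->
    forall X : seq C, uniq X -> (forall s, s \in X -> preim_box Phi w sigma T s) ->
    \sum_(s <- X) complex.Re s <= T * (g + e)) ->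
  (mean_counting Phi w <= (pi * g)%:E)%E.
Proof.
move=> g0 H; have pg0 : 0 <= pi * g :> R by rewrite mulr_ge0 ?pi_ge0.
apply: lime_le_ge0 => // e e0; near=> sigma.
have sigma0 : 0 < sigma by near: sigma; exact: nbhs_right_gt.
apply: (@le_trans _ _ (pi * g)%:E); last by rewrite lee_fin lerDl ltW.
apply: lime_le_ge0 => // {}e {}e0.
have pi0 : 0 < pi :> R := pi_gt0 R.
have [T0 HT0] := H sigma _ sigma0 (divr_gt0 e0 pi0).
near=> T.
have TT0 : T0 <= T by near: T; apply: nbhs_pinfty_ge; exact: num_real.
have T1 : 0 < T by near: T; apply: nbhs_pinfty_gt; exact: num_real.
apply: (@le_trans _ _ ((pi / T)%:E * (T * (g + e / pi))%:E)%E).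
  apply: lee_wpmul2l; first by rewrite lee_fin divr_ge0 // ltW.
  apply: ge_ereal_sup => _ [A [finA AS] <-].
  rewrite fsbig_finite //= sumEFin lee_fin.
  apply: (HT0 T TT0 (finmap.enum_fset (fset_set A))) => [|s]; first exact: finmap.fset_uniq.
  by rewrite in_fset_set // inE => /AS.
rewrite -EFinM lee_fin.
have -> // : pi / T * (T * (g + e / pi)) = pi * g + e.
by rewrite mulrA divfK ?gt_eqF // mulrDr mulrCA divff ?gt_eqF // mulr1.
Unshelve. all: by end_near.
Qed.

Lemma sumr_sqr_le_H2norm2 (a : nat -> C) N : inH2 a ->
  \sum_(k < N) cabs (a k) ^+ 2 <= H2norm2 a.
Proof.
move=> Ha; have := nondecreasing_cvgn_le _ Ha N; rewrite /series /= big_mkord.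
apply; apply: nondecreasing_series => k _ _; exact: sqr_ge0.
Qed.

Lemma H2norm2_le (a : nat -> C) (B : R) : inH2 a ->
  (forall N, \sum_(k < N) cabs (a k) ^+ 2 <= B) -> H2norm2 a <= B.
Proof.
move=> Ha aB; apply: limr_le => //; near=> N.
by rewrite /series /= big_mkord.
Unshelve. all: by end_near.
Qed.

Lemma H2_finite_support (a : nat -> C) N : (forall k, (N <= k)%N -> a k = 0) ->
  inH2 a /\ H2norm2 a = \sum_(k < N) cabs (a k) ^+ 2.
Proof.
move=> a0.
have h : (series (fun k => cabs (a k) ^+ 2) n @[n --> \oo] -->
    (\sum_(k < N) cabs (a k) ^+ 2 : R))%classic.
  apply: cvg_near_cst; near=> n.
  have Nn : (N <= n)%N by near: n; exact: nbhs_infty_ge.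
  rewrite /series /= (big_cat_nat (leq0n N) Nn) /= big_mkord.
  have -> : \sum_(N <= k < n) cabs (a k) ^+ 2 = 0.
    by rewrite big_nat big1 // => k /andP[Nk _]; rewrite a0 // cabs0 expr0n.
  by rewrite addr0.
split; first by apply/cvg_ex; eexists; exact: h.
exact: cvg_lim h.
Unshelve. all: by end_near.
Qed.

Lemma inH2_le (a : nat -> C) (B : R) :
  (forall N, \sum_(k < N) cabs (a k) ^+ 2 <= B) -> inH2 a.
Proof.
move=> aB; apply: nondecreasing_is_cvgn.
  by apply: nondecreasing_series => k _ _; exact: sqr_ge0.
by exists B => _ [N _ <-]; rewrite /series /= big_mkord.
Qed.

Lemma csum_to_unique (u : nat -> C) z z' : csum_to u z -> csum_to u z' -> z = z'.
Proof.
move=> uz uz'; apply/eqP; rewrite -subr_eq0 -cabs_eq0 eq_le cabs_ge0 andbT.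
apply/ler_addgt0Pr => e e0; rewrite add0r.
have [N HN] := uz _ (divr_gt0 e0 (ltr0n _ 2)).
have [M HM] := uz' _ (divr_gt0 e0 (ltr0n _ 2)).
have := HN _ (leq_maxl N M); have := HM _ (leq_maxr N M).
set S := \sum_(k < _) _ => h1 h2.
have -> : z - z' = (S - z') - (S - z) by ring.
by rewrite (le_trans (cabsB _ _)) // [e]splitr lerD ?ltW.
Qed.

Lemma csum_to_finite (u : nat -> C) N : (forall k, (N <= k)%N -> u k = 0) ->
  csum_to u (\sum_(k < N) u k).
Proof.
move=> u0 e e0; exists N => M NM.
have -> : \sum_(k < M) u k = \sum_(k < N) u k.
  rewrite [RHS](big_ord_widen M u NM) [RHS]big_mkcond; apply: eq_bigr => k _.
  by case: ltnP => // /u0.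
by rewrite subrr cabs0.
Qed.

(** Discrete comparison of x^(-1-p) with its integral, obtained from [exp x >= 1 + x] and
    [ln (1 + x) <= x]. *)
Lemma expR_telescope_le (p : R) n : 0 < p ->
  p * expR (- (1 + p) * ln n.+2%:R) <=
  expR (- p * ln n.+1%:R) - expR (- p * ln n.+2%:R).
Proof.
move=> p0; have n1 : 0 < n.+1%:R :> R by rewrite ltr0n.
have n2 : 0 < n.+2%:R :> R by rewrite ltr0n.
have -> : - (1 + p) * ln n.+2%:R = - ln n.+2%:R + - p * ln n.+2%:R :> R by ring.
rewrite expRD expRN lnK ?posrE //.
have -> : - p * ln n.+1%:R = - p * (ln n.+1%:R - ln n.+2%:R) + - p * ln n.+2%:R :> R by ring.
rewrite [expR (_ + _)]expRD -[X in _ <= _ - X]mul1r -mulrBl mulrA ler_wpM2r ?expR_ge0 //.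
have h : ln n.+1%:R - ln n.+2%:R <= - n.+2%:R^-1 :> R.
  rewrite -ln_div ?posrE //.
  have -> : n.+1%:R / n.+2%:R = 1 + (- n.+2%:R^-1) :> R.
    rewrite -[n.+2%:R]natr1; move: (n.+1%:R : R) n1 => x x0.
    have x1 : x + 1 != 0 by rewrite gt_eqF // addr_gt0.
    by field.
  by apply: le_ln1Dx; rewrite ltrN2 invf_lt1 // ltr1n.
have := expR_ge1Dx (- p * (ln n.+1%:R - ln n.+2%:R)).
rewrite -lerBrDl; apply: le_trans.
by rewrite mulNr -mulrN ler_pM2l // lerNr.
Qed.

Lemma sum_expR_ln_le (p : R) N : 0 < p ->
  \sum_(k < N) expR (- (1 + p) * ln k.+1%:R) <= 1 + p^-1.
Proof.
move=> p0; case: N => [|N].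
  by rewrite big_ord0 addr_ge0 // invr_ge0 ltW.
rewrite big_ord_recl /= ln1 mulr0 expR0 lerD2l.
suff h : p * \sum_(k < N) expR (- (1 + p) * ln k.+2%:R) <= 1 - expR (- p * ln N.+1%:R).
  rewrite -[leRHS]mulr1 ler_pdivlMl //; apply: (le_trans h).
  by rewrite gerBl expR_ge0.
elim: N => [|N IH]; first by rewrite big_ord0 mulr0 ln1 mulr0 expR0 subrr.
rewrite big_ord_recr /= mulrDr (le_trans (lerD IH (expR_telescope_le N p0))) //.
by rewrite addrA subrK.
Qed.

(* [ln n <= n ^ p / p] trades the logarithms for a small power. *)
Lemma sum_ln_sqr_le (y : R) : 1 < y -> exists Z : R, forall N,
  \sum_(k < N) ln k.+1%:R ^+ 2 * expR (- y * ln k.+1%:R) <= Z.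
Proof.
move=> y1; pose p := (y - 1) / 3.
have p0 : 0 < p by rewrite divr_gt0 // subr_gt0.
exists (p ^- 2 * (1 + p^-1)) => N.
apply: le_trans (ler_wpM2l _ (sum_expR_ln_le N p0)); last first.
  by rewrite invr_ge0 exprn_ge0 // ltW.
rewrite mulr_sumr; apply: ler_sum => k _.
have l0 := ln_nat_ge0 R k; move: (ln _) l0 => l l0.
rewrite ler_pdivlMl ?exprn_gt0 // mulrA -exprMn.
have -> : - (1 + p) * l = p * l + p * l + - y * l by rewrite /p; field.
rewrite expRD ler_wpM2r ?expR_ge0 // expRD -expr2 lerXn2r ?nnegrE ?expR_ge0 //.
  by rewrite mulr_ge0 // ltW.
by apply: le_trans (expR_ge1Dx _); rewrite lerDr.
Qed.

End Estimates.

(** * Bounds on the mean counting function *)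

Section Applications.
Variable R : realType.
Local Notation C := R[i].

Lemma dsum_limit (q : nat -> C) N (e : R) : 0 < e -> exists x1 : R, forall s,
  x1 <= complex.Re s -> cabs (dsum q N.+1 s - q 0) <= e.
Proof.
move=> e0; pose M : R := \sum_(k < N) cabs (q k.+1).
have M0 : 0 <= M by apply: sumr_ge0 => k _; exact: cabs_ge0.
have l2 : 0 < ln 2 :> R by rewrite ln_gt0 // ltr1n.
exists (M / (e * ln 2)) => s sx.
have s0 : 0 <= complex.Re s by apply: le_trans sx; rewrite divr_ge0 // mulr_ge0 // ltW.
rewrite /dsum big_ord_recl /= npow1 mulr1 addrAC subrr add0r.
rewrite (le_trans (cabs_sum _ _ _)) //.
apply: (@le_trans _ _ (\sum_(k < N) cabs (q k.+1) * (1 + complex.Re s * ln 2)^-1)).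
  apply: ler_sum => k _; rewrite cabsM ler_wpM2l ?cabs_ge0 // cabs_npow mulNr expRN.
  have p1 : 0 < 1 + complex.Re s * ln 2 by rewrite ltr_pwDl // mulr_ge0 // ltW.
  rewrite lef_pV2 ?posrE ?expR_gt0 //; apply: le_trans (expR_ge1Dx _) _.
  by rewrite ler_expR ler_wpM2l // ler_ln ?posrE // ler_nat.
rewrite -mulr_suml -/M ler_pdivrMr; last by rewrite ltr_pwDl // mulr_ge0 // ltW.
move: sx; rewrite ler_pdivrMr ?mulr_gt0 // => h.
by move: (ln 2) l2 h => l l0 h; rewrite mulrDr mulr1; nra.
Qed.

Lemma G0_limit (c : nat -> C) (Phi : C -> C) (e : R) : in_G0 c Phi -> 0 < e ->
  exists x1 : R, forall s, x1 <= complex.Re s -> cabs (Phi s - c 0) <= e.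
Proof.
move=> [H _] e0; have e2 : 0 < e / 2 by rewrite divr_gt0.
have [N HN] := H 1 ltr01 _ e2.
have [x1 Hx1] := dsum_limit c N e2.
exists (`|x1| + 2) => s sx.
have sx1 : x1 <= complex.Re s by have := ler_norm x1; lra.
have s1 : 1 < complex.Re s by have := normr_ge0 x1; lra.
have h1 : cabs (dsum c N.+1 s - Phi s) < e / 2 := HN N.+1 (leqnSn N) s s1.
have -> : Phi s - c 0 = (dsum c N.+1 s - c 0) - (dsum c N.+1 s - Phi s) by ring.
by rewrite (le_trans (cabsB _ _)) // [e]splitr lerD ?Hx1 ?(ltW h1).
Qed.

Lemma Re_G0_limit (c : nat -> C) (Phi : C -> C) : in_G0 c Phi -> 1 / 2 <= complex.Re (c 0).
Proof.
move=> G0; apply/ler_addgt0Pr => e e0.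
have [x1 Hx1] := G0_limit G0 e0.
have s1 : x1 <= complex.Re ((`|x1| + 1)%:C : C) by rewrite /= (le_trans (ler_norm _)) // lerDl.
have s0 : 0 < complex.Re ((`|x1| + 1)%:C : C) by rewrite /= ltr_wpDl.
have := Hx1 _ s1; have := G0.2 _ s0; have := Re_le_cabs (Phi (`|x1| + 1)%:C - c 0).
case: (Phi _) (c 0) => a b [a' b'] /=.
by rewrite ler_norml => /andP[]; lra.
Qed.

Section MeanSquareLimit.
Variables (F : C -> C) (b : nat -> C) (B x0 : R).
Hypothesis bB : forall N, \sum_(k < N) cabs (b k) ^+ 2 <= B.
Hypothesis bF : forall s, 1 / 2 < complex.Re s -> csum_to (dterm b s) (F s).
Hypothesis x00 : 0 <= x0.
Hypothesis cF : uclos (rhalf x0) (@is_dpoly R) F.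

Lemma dirichlet_limit (e : R) : 0 < e -> exists x1 : R, forall s,
  x1 <= complex.Re s -> cabs (F s - b 0) <= e.
Proof.
move=> e0; have e8 : 0 < e / 8 by rewrite divr_gt0.
have [g [N [q [q0 qE]]] Fg] := cF e8.
have Fq s : rhalf x0 s -> cabs (F s - dsum q N s) <= e / 8 by move=> /Fg; rewrite qE.
have := coef_close bB bF x00 e8 q0 Fq 0; rewrite npow1 cabs1 mulr1 => qb.
have [x1 Hx1] := dsum_limit q N e8.
exists (`|x1| + x0 + 1) => s sx.
have sx1 : x1 <= complex.Re s by have := ler_norm x1; move: x00; lra.
have sx0 : rhalf x0 s by rewrite /rhalf; have := normr_ge0 x1; lra.
have h1 := Hx1 s sx1; have h2 := Fq s sx0.
rewrite (dsum_widen s (leqnSn N) q0) in h2.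
have -> : F s - b 0 = (F s - dsum q N.+1 s) + ((dsum q N.+1 s - q 0) + (q 0 - b 0)) by ring.
rewrite (le_trans (cabsD _ _)) //.
have := cabsD (dsum q N.+1 s - q 0) (q 0 - b 0); lra.
Qed.
End MeanSquareLimit.

Variables (c : nat -> C) (Phi : C -> C).
Hypothesis G0 : in_G0 c Phi.

Lemma cayley_npow (rho s0 r y : R) n : rho < 1 ->
  uclos (disc rho) (@is_poly R) (fun z => npow n (cayley s0 r y z)).
Proof.
by move=> rho1; apply: uclos_npow (poly_bounded_algebra _) _; exact: uclos_cayley.
Qed.

Lemma disc_rhalf (rho s0 r y : R) : rho < 1 -> 0 < r ->
  forall z, disc rho z -> s0 < complex.Re (cayley s0 r y z).
Proof. by move=> rho1 r0 z zD; apply: Re_cayley_gt => //; exact: le_lt_trans rho1. Qed.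

Lemma mean_counting_jensen (F : C -> C) (Finf w : C) (B : R) : 0 <= B -> Finf != 0 ->
  cabs Finf ^+ 2 <= B ->
  (forall s, Phi s = w -> F s = 0) ->
  (forall e : R, 0 < e -> exists x1 : R, forall s : C,
    x1 <= complex.Re s -> cabs (F s - Finf) <= e) ->
  (forall s0 rho r y : R, 0 < s0 -> rho < 1 -> 0 < r ->
    uclos (disc rho) (@is_poly R) (fun z => F (cayley s0 r y z))) ->
  (forall s0 e : R, 0 < s0 -> 0 < e -> exists2 h : R, 0 < h <= 1 &
    exists L0, forall L, (0 < L)%N -> (L0 <= L)%N -> forall s, rhalf s0 s ->
    L%:R^-1 * (\sum_(j < L) cabs (F (s + (0 +i* (h * j%:R)))) ^+ 2) <= B + e) ->
  (mean_counting Phi w <= (pi * (20 * (B / cabs Finf ^+ 2 - 1)))%:E)%E.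
Proof.
move=> B0 Finf0 FB Fw Flim Fcay Fmean.
apply: mean_counting_le.
  by rewrite mulr_ge0 // subr_ge0 ler_pdivlMr ?mul1r // exprn_gt0 // cabs_gt0.
(* With [s0 = sigma / 2], the condition [2 * s0 < Re s] of [counting_le] is the cut-off in
   [preim_box]. *)
move=> sigma e sigma0 e0; have s00 : 0 < sigma / 2 by rewrite divr_gt0.
have [T0 HT0] := @counting_le R F Finf B (sigma / 2) s00 B0 Finf0 Flim
  (fun rho r y rho0 rho1 r0 => Fcay _ rho r y s00 rho1 r0) (fun e => Fmean _ e s00) e e0.
exists T0 => T TT X uX XF; apply: HT0 => // s sX.
have [Fs [sT ss]] := XF s sX; split=> //; first exact: Fw.
by rewrite mulrC divfK.
Qed.

Lemma moebius_mean_counting_le (w : C) : 1 / 2 < complex.Re w -> w != c 0 ->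
  (mean_counting Phi w <= (pi * (20 * ((cabs (moebius w (c 0)) ^+ 2)^-1 - 1)))%:E)%E.
Proof.
move=> hw wc; have hc := Re_G0_limit G0.
pose m := complex.Re w - 1 / 2; have m0 : 0 < m by rewrite subr_gt0.
have Rev u : 1 / 2 <= complex.Re u -> m <= cabs (u + (w^* - 1)).
  move=> hu; apply: le_trans (Re_le_cabs _); apply: le_trans (ler_norm _).
  by rewrite /m; case: (u) hu => a b; case: (w) => p q /=; lra.
have v0 u : 1 / 2 <= complex.Re u -> u + (w^* - 1) != 0.
  by move=> /Rev h; rewrite -cabs_gt0; exact: lt_le_trans h.
have le1 u : 1 / 2 <= complex.Re u -> cabs (moebius w u) ^+ 2 <= 1.
  move=> hu; rewrite /moebius cabsM cabsV exprMn exprVn ler_pdivrMr; last first.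
    by rewrite exprn_gt0 // cabs_gt0 v0.
  rewrite mul1r !sqr_cabs; move: hu hw; case: (u) => a b; case: (w) => p q /= h1 h2.
  by have : 0 <= (a - 1 / 2) * (p - 1 / 2); [apply: mulr_ge0; lra | nra].
have Finf0 : moebius w (c 0) != 0.
  by rewrite /moebius mulf_neq0 ?invr_neq0 ?v0 // subr_eq0 eq_sym.
(* [Phi] is unconstrained off the right half-plane; cutting off there makes the modulus at most 1
   everywhere, so [B = 1]. *)
have := @mean_counting_jensen (fun s => if 0 < complex.Re s then moebius w (Phi s) else 0)
  (moebius w (c 0)) w 1 ler01 Finf0 (le1 _ hc).
rewrite div1r; apply.
- by move=> s sw; case: ifP => // _; rewrite /moebius sw subrr mul0r.
- move=> e e0.
  pose K := cabs (w^* - 1 + w) / m ^+ 2 + 1.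
  have K0 : 0 < K by rewrite /K ltr_wpDl // divr_ge0 ?cabs_ge0 ?sqr_ge0.
  have [x1 Hx1] := G0_limit G0 (divr_gt0 e0 K0).
  exists (`|x1| + 1) => s sx.
  have s0 : 0 < complex.Re s by have := normr_ge0 x1; lra.
  have sx1 : x1 <= complex.Re s by have := ler_norm x1; lra.
  rewrite s0; have h1 := Hx1 s sx1; have hP := ltW (G0.2 s s0).
  have -> : moebius w (Phi s) - moebius w (c 0) = (Phi s - c 0) * ((w^* - 1 + w) /
      ((Phi s + (w^* - 1)) * (c 0 + (w^* - 1)))).
    rewrite /moebius; have := v0 _ hP; have := v0 _ hc.
    by move: (Phi s) (c 0) (w^* - 1) => u u' v v1 v2; field; apply/andP; split.
  rewrite cabsM -[e](@divfK _ K) ?gt_eqF //; apply: ler_pM; rewrite ?cabs_ge0 //.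
  rewrite cabsM cabsV cabsM /K; apply: (@le_trans _ _ (cabs (w^* - 1 + w) / m ^+ 2)).
    rewrite ler_wpM2l ?cabs_ge0 // lef_pV2 ?posrE ?exprn_gt0 ?mulr_gt0 ?cabs_gt0 ?v0 //.
    by rewrite expr2 ler_pM ?(ltW m0) ?Rev.
  by rewrite lerDl.
- move=> s0 rho r y s00 rho1 r0.
  have h := @uclos_moebius_G0 R c Phi G0 C (disc rho) (@is_poly R) (poly_bounded_algebra _)
    (cayley s0 r y) s0 s00 (@disc_rhalf rho s0 r y rho1 r0) (fun n => @cayley_npow rho s0 r y n.+1 rho1) w hw.
  apply: uclos_eq h => z zD.
  by rewrite (lt_trans s00 (@disc_rhalf rho s0 r y rho1 r0 z zD)).
- move=> s0 e s00 e0; exists 1; first by rewrite ltr01 lexx.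
  exists 0 => L L0 _ s ss.
  apply: le_trans (_ : 1 <= _); last by rewrite lerDl ltW.
  apply: (mean_le (f := fun j => cabs (if 0 < complex.Re (s + (0 +i* (1 * j%:R))) then
    moebius w (Phi (s + (0 +i* (1 * j%:R)))) else 0) ^+ 2)) => // j.
  by case: ifP => h; rewrite ?cabs0 ?expr0n //= le1 // ltW // G0.2.
Qed.

(** Here F = 1 + t f' o Phi. The condition [t ^+ 2 * H <= 1 / 4] forces [|t b_0| <= 1 / 2], hence
    [|F(+oo)| >= 1 / 2]. Keeping the constant coefficient exact in [B] leaves only
    [t ^+ 2 * H / |F(+oo)|^2], at most [4 * (t ^+ 2 * H)], after subtracting 1. *)
Lemma test_mean_counting_le (a b : nat -> C) N (w : C) (t H : R) :
  (forall k, (N <= k)%N -> a k = 0) -> 1 / 2 < complex.Re w -> DPhi_rel Phi a b ->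
  (forall M, \sum_(k < M) cabs (b k) ^+ 2 <= H) -> 0 < t ->
  t%:C * \sum_(k < N) dterm_deriv a w k = -1 -> t ^+ 2 * H <= 1 / 4 ->
  (mean_counting Phi w <= (pi * (20 * (4 * (t ^+ 2 * H))))%:E)%E.
Proof.
move=> a0 hw Hab bH t0 tw tH.
pose q (k : nat) : C := t%:C * - (a k * (ln k.+1%:R)%:C).
pose F s : C := 1 + \sum_(k < N) q k * npow k.+1 (Phi s).
pose bF (k : nat) : C := (if k == 0%N then 1 else 0) + t%:C * b k.
have qE u : \sum_(k < N) q k * npow k.+1 u = t%:C * \sum_(k < N) dterm_deriv a u k.
  by rewrite mulr_sumr; apply: eq_bigr => k _; rewrite /q /dterm_deriv mulrA.
have H0 : 0 <= H by have := bH 0; rewrite big_ord0.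
have b0H : cabs (t%:C * b 0) ^+ 2 <= t ^+ 2 * H.
  rewrite cabsM cabs_real gtr0_norm // exprMn ler_wpM2l ?sqr_ge0 //.
  by have := bH 1; rewrite big_ord_recl big_ord0 addr0.
have bF0 : bF 0 = 1 + t%:C * b 0 by [].
have Finf : 1 / 2 <= cabs (bF 0).
  have h : cabs (t%:C * b 0) <= 1 / 2.
    by rewrite -(@ler_pXn2r _ 2) ?nnegrE ?cabs_ge0 //; lra.
  have := cabsB (bF 0) (t%:C * b 0); rewrite bF0 addrK cabs1; lra.
pose B := cabs (bF 0) ^+ 2 + t ^+ 2 * H.
have tH0 : 0 <= t ^+ 2 * H by rewrite mulr_ge0 // sqr_ge0.
have bFB M : \sum_(k < M) cabs (bF k) ^+ 2 <= B.
  case: M => [|M]; first by rewrite big_ord0 addr_ge0 ?sqr_ge0.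
  rewrite big_ord_recl lerD2l //=.
  apply: (@le_trans _ _ (t ^+ 2 * \sum_(k < M.+1) cabs (b k) ^+ 2)).
    rewrite big_ord_recl mulrDr; apply: (@le_trans _ _ (t ^+ 2 * \sum_(k < M) cabs (b k.+1) ^+ 2)).
      rewrite mulr_sumr; apply: ler_sum => k _.
      by rewrite /bF /= add0r cabsM cabs_real gtr0_norm // exprMn.
    by rewrite lerDr mulr_ge0 // sqr_ge0.
  by rewrite ler_wpM2l ?sqr_ge0.
have bFF s : 1 / 2 < complex.Re s -> csum_to (dterm bF s) (F s).
  move=> hs; have [z [za zb]] := Hab s hs.
  have zE : z = \sum_(k < N) dterm_deriv a (Phi s) k.
    apply: csum_to_unique za _; apply: csum_to_finite => k /a0 ak.
    by rewrite /dterm_deriv ak mul0r oppr0 mul0r.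
  move=> e e0; have [M0 HM0] := zb _ (divr_gt0 e0 t0).
  exists M0.+1 => -[|M] // MM.
  have -> : \sum_(k < M.+1) dterm bF s k = 1 + t%:C * \sum_(k < M.+1) dterm b s k.
    rewrite /dterm mulr_sumr !big_ord_recl /bF /= npow1 !mulr1 addrA; congr (_ + _).
    by apply: eq_bigr => k _; rewrite add0r mulrA.
  rewrite /F qE -zE opprD addrACA subrr add0r -mulrBr cabsM cabs_real gtr0_norm //.
  by rewrite -ltr_pdivlMl // mulrC HM0 // (leq_trans _ MM).
have cF s0 : 0 < s0 -> uclos (rhalf s0) (@is_dpoly R) F.
  move=> s00; have AD := dpoly_bounded_algebra (ltW s00).
  apply: (uclos_dpoly_G0 G0 AD s00 (s := id)) => // n.
  apply: uclos_sub; apply: is_dpoly_ext (is_dpoly_term 1 n) => s.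
  by rewrite mul1r.
have F20 : 0 < cabs (bF 0) ^+ 2 by rewrite exprn_gt0 //; lra.
apply: le_trans (@mean_counting_jensen F (bF 0) w B _ _ _ _ _ _ _) _.
- by rewrite addr_ge0 // ltW.
- by rewrite -cabs_gt0; lra.
- by rewrite lerDl.
- by move=> s sw; rewrite /F qE sw tw subrr.
- by move=> e e0; exact: (dirichlet_limit bFB bFF ler01 (cF 1 ltr01)).
- move=> s0 rho r y s00 rho1 r0.
  apply: (uclos_dpoly_G0 G0 (poly_bounded_algebra _) s00 (@disc_rhalf rho s0 r y rho1 r0)).
  by move=> n; exact: cayley_npow.
- by move=> s0 e s00 e0; exact: (mean_square_le bFB bFF (ltW s00) (cF s0 s00)).
rewrite lee_fin ler_wpM2l ?pi_ge0 // ler_pM2l // /B mulrDl divff ?gt_eqF // addrAC subrr add0r.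
have F4 : (1 / 2) ^+ 2 <= cabs (bF 0) ^+ 2.
  by rewrite lerXn2r ?nnegrE ?cabs_ge0 //; lra.
rewrite ler_pdivrMr //; move: (t ^+ 2 * H) tH0 (cabs _ ^+ 2) F4 => x xx y y1.
by rewrite -[leLHS]mulr1 -mulrA [4 * _]mulrCA ler_wpM2l //; lra.
Qed.

End Applications.

(** * Test functions *)

Section Kernel.
Variable R : realType.
Local Notation C := R[i].

(** Comparison with the integral of ln(x)^2 / x, which is ln(x)^3 / 3; the extra factor 2 pays for
    [ln (N+2) - ln (N+1) <= 2 / (N+2)]. *)
Lemma sum_ln_sqr_inv_ge N :
  ln N.+1%:R ^+ 3 / 6 <= \sum_(k < N.+1) ln k.+1%:R ^+ 2 / k.+1%:R :> R.
Proof.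
elim: N => [|N IH]; first by rewrite big_ord_recr big_ord0 /= ln1 !expr0n /= !mul0r addr0.
rewrite big_ord_recr /=; apply: le_trans (lerD IH (lexx _)).
have n1 : 0 < N.+1%:R :> R by rewrite ltr0n.
have l0 := ln_nat_ge0 R N.
have l1 : ln N.+1%:R <= ln N.+2%:R :> R by rewrite ler_ln ?posrE ?ltr0n // ler_nat.
have d : ln N.+2%:R - ln N.+1%:R <= 2 / N.+2%:R :> R.
  apply: (@le_trans _ _ N.+1%:R^-1).
    rewrite -ln_div ?posrE ?ltr0n //.
    have -> : N.+2%:R / N.+1%:R = 1 + N.+1%:R^-1 :> R.
      by rewrite -[N.+2%:R]natr1 mulrDl divff ?gt_eqF // mul1r.
    by apply: le_ln1Dx; apply: (@lt_trans _ _ 0); rewrite ?ltrN10 // invr_gt0.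
  rewrite ler_pdivlMr ?ltr0n // mulrC ler_pdivrMr // -natrM ler_nat; lia.
have i0 : 0 <= 2 / N.+2%:R :> R by rewrite divr_ge0.
have -> : ln N.+2%:R ^+ 2 / N.+2%:R = ln N.+2%:R ^+ 2 * (2 / N.+2%:R) / 2 :> R.
  have n2 : N.+2%:R != 0 :> R by rewrite pnatr_eq0.
  by move: (ln N.+2%:R : R) (N.+2%:R : R) n2 => l n n0; field.
move: (ln _) (ln _) (2 / _) l0 l1 d i0 => y x z x0 xy d z0.
have h1 : y ^+ 2 * (y - x) <= y ^+ 2 * z by rewrite ler_wpM2l // sqr_ge0.
have h2 : x ^+ 2 <= y ^+ 2 by rewrite lerXn2r ?nnegrE // (le_trans x0).
have h3 : x * y <= y ^+ 2 by rewrite expr2 ler_wpM2r // (le_trans x0).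
have h4 : (y - x) * (y ^+ 2 + x * y + x ^+ 2) <= (y - x) * (3 * y ^+ 2).
  by rewrite ler_wpM2l ?subr_ge0 //; lra.
have h5 : y ^+ 3 - x ^+ 3 = (y - x) * (y ^+ 2 + x * y + x ^+ 2) by ring.
by lra.
Qed.

(* The squared norm of the functional [f |-> f'(w)] on Dirichlet polynomials of
   length N. *)
Definition kernel_sum (w : C) N : R :=
  \sum_(k < N) ln k.+1%:R ^+ 2 * cabs (npow k.+1 w) ^+ 2.

Definition kernel_const : R := expR (-2) / 48.

Lemma kernel_const_gt0 : 0 < kernel_const.
Proof. by rewrite divr_gt0 // expR_gt0. Qed.

(** Let [p] = Re w - 1/2. The sum is cut at the integer part of exp(1/p): up to there n^(-2p) >=
    e^(-2), while the logarithm of the length is at least 1/p - 1 >= 1/(2p). Then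
    [sum_ln_sqr_inv_ge] gives e^(-2) (1/(2p))^3 / 6, hence the 48. *)
Lemma kernel_sum_ge (w : C) : 1 / 2 < complex.Re w -> complex.Re w <= 1 ->
  exists N, kernel_const <= kernel_sum w N * (complex.Re w - 1 / 2) ^+ 3.
Proof.
move=> hw hw1; pose p := complex.Re w - 1 / 2.
have p0 : 0 < p by rewrite subr_gt0.
have p1 : p <= 1 / 2 by rewrite /p; lra.
pose n := (Num.trunc (expR p^-1)).-1.
have pinv : 2 <= p^-1 by rewrite -[2]invrK lef_pV2 ?posrE ?invr_gt0 //; lra.
have E1 : 1 <= expR p^-1 by apply: le_trans (expR_ge1Dx _); lra.
have nE : n.+1 = Num.trunc (expR p^-1) by rewrite prednK // truncn_gt0.
have n1 : 0 < n.+1%:R :> R by rewrite ltr0n.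
have nle : n.+1%:R <= expR p^-1 by rewrite nE truncn_le expR_ge0.
have nge : expR p^-1 <= n.+1%:R * expR 1.
  have h : expR p^-1 < n.+1%:R + 1 by rewrite natr1 nE truncnS_gt.
  have : 1 + 1 <= expR 1 :> R := expR_ge1Dx 1.
  have : 1 <= n.+1%:R :> R by rewrite ler1n.
  move: (n.+1%:R) (expR 1) h => x y h hx hy; nra.
have lnle : ln n.+1%:R <= p^-1 by rewrite -[leRHS]expRK ler_ln ?posrE ?expR_gt0.
have lnge : p^-1 / 2 <= ln n.+1%:R.
  have : p^-1 <= ln n.+1%:R + 1.
    rewrite -[leLHS]expRK -[X in _ <= _ + X]expRK -lnM ?posrE ?expR_gt0 //.
    by rewrite ler_ln ?posrE ?mulr_gt0 ?expR_gt0.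
  by lra.
exists n.+1.
have h1 : expR (-2) * \sum_(k < n.+1) ln k.+1%:R ^+ 2 / k.+1%:R <= kernel_sum w n.+1.
  rewrite mulr_sumr; apply: ler_sum => k _.
  rewrite mulrCA ler_wpM2l ?sqr_ge0 // cabs_npow -expRM_natr.
  have k0 : 0 < k.+1%:R :> R by rewrite ltr0n.
  rewrite -[X in _ / X]lnK ?posrE // -expRN -expRD ler_expR.
  have lk : ln k.+1%:R <= p^-1 :> R.
    by apply: le_trans lnle; rewrite ler_ln ?posrE // ler_nat.
  have : p * ln k.+1%:R <= 1 by rewrite -ler_pdivlMl // mulr1.
  by rewrite /p; lra.
apply: le_trans (ler_wpM2r _ h1); last by rewrite exprn_ge0 // ltW.
have h2 : (p^-1 / 2) ^+ 3 / 6 <= \sum_(k < n.+1) ln k.+1%:R ^+ 2 / k.+1%:R.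
  apply: le_trans (sum_ln_sqr_inv_ge n); rewrite ler_pM2r ?invr_gt0 //.
  by rewrite lerXn2r ?nnegrE ?ln_nat_ge0 // divr_ge0 // invr_ge0 ltW.
rewrite -/p /kernel_const -mulrA ler_pM2l ?expR_gt0 //.
apply: le_trans (ler_wpM2r _ h2); last by rewrite exprn_ge0 // ltW.
by rewrite le_eqVlt; apply/orP; left; apply/eqP; field; rewrite gt_eqF.
Qed.

(** Up to sign, the unit vector representing f |-> f'(w) on Dirichlet polynomials of length [N]; its
    derivative at [w] is minus the square root of [kernel_sum]. The truncation keeps f a polynomial,
    so that f' o Phi lies in the uniform closures. *)
Definition kernel_coef (w : C) N (k : nat) : C :=
  if (k < N)%N then ((Num.sqrt (kernel_sum w N))^-1 * ln k.+1%:R)%:C * (npow k.+1 w)^*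
  else 0.

Section KernelCoef.
Variables (w : C) (N : nat).
Hypothesis S0 : 0 < kernel_sum w N.

Lemma kernel_coef_support k : (N <= k)%N -> kernel_coef w N k = 0.
Proof. by rewrite /kernel_coef ltnNge => ->. Qed.

Lemma kernel_coef_norm : inH2 (kernel_coef w N) /\ H2norm2 (kernel_coef w N) = 1.
Proof.
have [h ->] := H2_finite_support kernel_coef_support; split => //.
have -> : 1 = (kernel_sum w N)^-1 * kernel_sum w N by rewrite mulVf // gt_eqF.
rewrite [X in _ = _ * X]/kernel_sum mulr_sumr; apply: eq_bigr => k _.
rewrite /kernel_coef ltn_ord cabsM cabs_conj cabs_real !exprMn real_normK ?num_real //.
by rewrite exprMn exprVn sqr_sqrtr ?(ltW S0) // [RHS]mulrA.
Qed.

Lemma kernel_coef_deriv :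
  ((Num.sqrt (kernel_sum w N))^-1)%:C * \sum_(k < N) dterm_deriv (kernel_coef w N) w k = -1.
Proof.
set r := Num.sqrt _; have r0 : 0 < r by rewrite sqrtr_gt0.
have rE : r ^+ 2 = kernel_sum w N by rewrite sqr_sqrtr // ltW.
have -> : \sum_(k < N) dterm_deriv (kernel_coef w N) w k = - (r^-1 * kernel_sum w N)%:C.
  rewrite /kernel_sum mulr_sumr rmorph_sum -sumrN; apply: eq_bigr => k _.
  rewrite /dterm_deriv /kernel_coef ltn_ord -/r /=.
  set l := ln _; set p := npow _ _.
  have -> : (r^-1 * (l ^+ 2 * cabs p ^+ 2))%:C = (r^-1 * l)%:C * l%:C * (cabs p ^+ 2)%:C.
    by rewrite -!rmorphM /=; congr (_ %:C); ring.
  by rewrite sqr_cabsC mulNr (mulrC p) mulrA [X in X * p]mulrAC.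
rewrite mulrN -rmorphM /= -rE; congr (- _%:C).
by rewrite -[RHS]/(1 : R); field; rewrite gt_eqF.
Qed.

(** Quantifies the weak convergence of the kernels to 0: at a fixed [u], [Z] does not depend on [w]
    or [N], while [kernel_sum] tends to infinity as [w] nears the boundary. *)
Lemma kernel_coef_deriv_le (u : C) (Z : R) : 1 / 2 <= complex.Re w ->
  (forall M, \sum_(k < M) ln k.+1%:R ^+ 2 * expR (- (1 / 2 + complex.Re u) * ln k.+1%:R) <= Z) ->
  cabs (\sum_(k < N) dterm_deriv (kernel_coef w N) u k) <=
    (Num.sqrt (kernel_sum w N))^-1 * Z.
Proof.
move=> hw uZ; rewrite (le_trans (cabs_sum _ _ _)) //.
have r0 : 0 <= (Num.sqrt (kernel_sum w N))^-1 by rewrite invr_ge0 sqrtr_ge0.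
apply: le_trans (ler_wpM2l r0 (uZ N)); rewrite mulr_sumr; apply: ler_sum => k _.
have l0 := ln_nat_ge0 R k.
rewrite /dterm_deriv /kernel_coef ltn_ord mulNr cabsN !cabsM cabs_conj !cabs_real.
rewrite !ger0_norm ?mulr_ge0 // !cabs_npow.
have -> : - (1 / 2 + complex.Re u) * ln k.+1%:R = - (1 / 2) * ln k.+1%:R + - complex.Re u * ln k.+1%:R by ring.
rewrite expRD; set r := (Num.sqrt _)^-1; set l := ln _; set e1 := expR _.
have -> : r * l * e1 * l * expR (- complex.Re u * l) =
  r * (l ^+ 2 * (e1 * expR (- complex.Re u * l))) by ring.
rewrite ler_wpM2l // ler_wpM2l ?sqr_ge0 // ler_wpM2r ?expR_ge0 // ler_expR.
by rewrite ler_wpM2r // lerN2.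
Qed.

End KernelCoef.

Lemma kernel_mean_counting_le (c : nat -> C) (Phi : C -> C) (w : C) N (b : nat -> C) :
  in_G0 c Phi -> 1 / 2 < complex.Re w -> 0 < kernel_sum w N ->
  DPhi_rel Phi (kernel_coef w N) b -> inH2 b -> 4 * H2norm2 b <= kernel_sum w N ->
  (mean_counting Phi w <= (80 * pi * (H2norm2 b / kernel_sum w N))%:E)%E.
Proof.
move=> G0 hw S0 Hb b2 bS.
pose t := (Num.sqrt (kernel_sum w N))^-1.
have t0 : 0 < t by rewrite invr_gt0 sqrtr_gt0.
have tE : t ^+ 2 = (kernel_sum w N)^-1 by rewrite exprVn sqr_sqrtr // ltW.
have tH : t ^+ 2 * H2norm2 b <= 1 / 4.
  by rewrite tE ler_pdivrMl //; lra.
have := test_mean_counting_le G0 (@kernel_coef_support w N) hw Hb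
  (fun M => sumr_sqr_le_H2norm2 M b2) t0 (kernel_coef_deriv S0) tH.
move/le_trans; apply; rewrite lee_fin tE le_eqVlt; apply/orP; left; apply/eqP.
by field; rewrite gt_eqF.
Qed.

(* Evaluate at large real s: the k-th term dominates the tail, and the previous
   coefficients already tend to 0. *)
Lemma coef_decay (b : nat -> nat -> C) (K : R) :
  (forall n M, \sum_(k < M) cabs (b n k) ^+ 2 <= K) ->
  (forall (s : C) (d : R), 1 / 2 < complex.Re s -> 0 < d -> exists n0, forall n, (n0 <= n)%N ->
    exists2 z, csum_to (dterm (b n) s) z & cabs z <= d) ->
  forall k (d : R), 0 < d -> exists n0, forall n, (n0 <= n)%N -> cabs (b n k) <= d.
Proof.
move=> bK bz.
have K0 : 0 <= K by have := bK 0 0; rewrite big_ord0.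
have bK1 n k : cabs (b n k) <= 1 + K by exact: coef_le (bK n) k.
move=> k; elim/ltn_ind: k => k IH d d0.
pose x : R := k.+1%:R; have x0 : 0 < x by rewrite ltr0n.
pose y : R := k.+2%:R; have y0 : 0 < y by rewrite ltr0n.
(* At s = m + 2 the tail, relative to the k-th term, is at most a constant times [(x / y) ^+ m], two
   powers being spent on summing 1/j^2. So [m] comes first and takes [d / 4]; then [n] is taken
   large so that the head, the value [z] and the truncation error take [d / 4] each. *)
have [m Hm] : exists m : nat, (x / y) ^+ m < d / (4 * (1 + K) * x ^+ 2).
  apply: exprn_small; first by rewrite divr_ge0 // ltW.
    by rewrite ltr_pdivrMr // mul1r ltr_nat.
  by rewrite divr_gt0 // mulr_gt0 ?exprn_gt0 // mulr_gt0 //; lra.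
pose s : C := (m.+2%:R)%:C.
have v j : cabs (npow j.+1 s) = j.+1%:R ^- m.+2.
  rewrite cabs_npow /= mulNr expRN; congr (_^-1).
  by rewrite expRM_natl lnK // posrE ltr0n.
pose W := x ^+ m.+2; have W0 : 0 < W by rewrite exprn_gt0.
have sRe : 1 / 2 < complex.Re s.
  by rewrite /s /=; apply: (@lt_le_trans _ _ 1); rewrite ?ler1n //; lra.
have [n1 Hn1] := bz s _ sRe (divr_gt0 d0 (mulr_gt0 (ltr0n _ 4) W0)).
have dk : 0 < d / (4 * W * x) by exact: (divr_gt0 d0 (mulr_gt0 (mulr_gt0 (ltr0n _ 4) W0) x0)).
have [n2 Hn2] : exists n0, forall n, (n0 <= n)%N -> forall j, (j < k)%N -> cabs (b n j) <= d / (4 * W * x).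
  have h j : exists n0, forall n, (n0 <= n)%N -> (j < k)%N -> cabs (b n j) <= d / (4 * W * x).
    have [jk|jk] := ltnP j k; last by exists 0.
    by have [n0 Hn0] := IH j jk _ dk; exists n0 => n /Hn0.
  have [n0 Hn0] := finite_eventually h k.
  by exists n0 => n nn0 j jk; exact: Hn0.
exists (maxn n1 n2) => n; rewrite geq_max => /andP[nn1 nn2].
have [z bsz zd] := Hn1 n nn1.
have [M0 HM0] := bsz _ (divr_gt0 d0 (mulr_gt0 (ltr0n _ 4) W0)).
pose M := (M0 + k.+1)%N.
have := HM0 M (leq_addr _ _); set Sg := \sum_(j < M) _ => SM.
have kM : (k.+1 <= M)%N by exact: leq_addl.
have SgE : Sg = \sum_(j < k) dterm (b n) s j + b n k * npow k.+1 s +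
   \sum_(k.+1 <= j < M) dterm (b n) s j.
  by rewrite /Sg -(big_mkord predT) (big_cat_nat (leq0n k.+1) kM) /= big_mkord big_ord_recr.
have hd : cabs (\sum_(j < k) dterm (b n) s j) <= d / (4 * W).
  rewrite (le_trans (cabs_sum _ _ _)) //.
  apply: (@le_trans _ _ (\sum_(j < k) d / (4 * W * x))).
    apply: ler_sum => j _; rewrite cabsM -[leRHS]mulr1.
    by apply: ler_pM; rewrite ?cabs_ge0 ?Hn2 // cabs_npow_le1.
  rewrite sumr_const card_ord -[leLHS]mulr_natl.
  have -> : d / (4 * W) = x * (d / (4 * W * x)) by field; rewrite !gt_eqF.
  by rewrite ler_wpM2r ?(ltW dk) // ler_nat.
have tl : cabs (\sum_(k.+1 <= j < M) dterm (b n) s j) <= (1 + K) * y ^- m.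
  rewrite (le_trans (cabs_sum _ _ _)) //.
  apply: (@le_trans _ _ (\sum_(k.+1 <= j < M) (1 + K) * y ^- m * j.+1%:R ^- 2)).
    rewrite big_nat [leRHS]big_nat; apply: ler_sum => j /andP[kj _].
    rewrite cabsM -mulrA; apply: ler_pM; rewrite ?cabs_ge0 // v -addn2 exprD invfM.
    rewrite ler_wpM2r ?invr_ge0 ?exprn_ge0 //.
    by rewrite lef_pV2 ?posrE ?exprn_gt0 ?ltr0n // lerXn2r ?nnegrE // ler_nat.
  rewrite -mulr_sumr -[leRHS]mulr1 ler_wpM2l ?mulr_ge0 ?invr_ge0 ?exprn_ge0 ?(ltW y0) //.
    by lra.
  rewrite /M addnS; apply: (le_trans (inv_sqr_telescope_le R (leq_addl M0 k))).
  apply: (@le_trans _ _ (k.+1%:R^-1)); first by rewrite gerBl invr_ge0.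
  by rewrite invf_le1 // ler1n.
have : cabs (b n k * npow k.+1 s) <= d / (4 * W) * 3 + (1 + K) * y ^- m.
  have -> : b n k * npow k.+1 s = ((Sg - z) + z) -
    (\sum_(j < k) dterm (b n) s j + \sum_(k.+1 <= j < M) dterm (b n) s j).
    by rewrite SgE; ring.
  rewrite (le_trans (cabsB _ _)) //.
  have := cabsD (Sg - z) z.
  have := cabsD (\sum_(j < k) dterm (b n) s j) (\sum_(k.+1 <= j < M) dterm (b n) s j).
  by move: hd tl zd (ltW SM); move: (d / _) ((1 + K) * _) => *; lra.
rewrite cabsM v -/x -/W ler_pdivrMr // => /le_trans; apply.
have -> : (d / (4 * W) * 3 + (1 + K) * y ^- m) * W = 3 / 4 * d + (1 + K) * x ^+ 2 * (x / y) ^+ m.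
  have WE : W = x ^+ m * x ^+ 2 by rewrite /W -addn2 exprD.
  have Wn : W != 0 by rewrite gt_eqF.
  rewrite expr_div_n mulrDl; congr (_ + _); first by field.
  by rewrite WE; ring.
have D0 : 0 < (1 + K) * x ^+ 2 by rewrite mulr_gt0 ?exprn_gt0 //; lra.
have := ltW Hm; rewrite -(ler_pM2l D0).
have -> : (1 + K) * x ^+ 2 * (d / (4 * (1 + K) * x ^+ 2)) = d / 4.
  by field; rewrite !gt_eqF //; lra.
by lra.
Qed.

End Kernel.

(** * The uniform bound and its refinement for compact operators *)

Section Main.
Variable R : realType.
Local Notation C := R[i].
Variables (c : nat -> C) (Phi : C -> C).
Hypothesis G0 : in_G0 c Phi.

Lemma lt_of_mean_counting_le (m : \bar R) (x r y : R) : (m <= x%:E)%E -> 0 < r -> x < y * r ->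
  (m * r^-1%:E < y%:E)%E.
Proof.
move=> mx r0 xy; apply: (@le_lt_trans _ _ (x%:E * r^-1%:E)%E).
  by apply: lee_wpmul2r => //; rewrite lee_fin invr_ge0 ltW.
by rewrite -EFinM lte_fin ltr_pdivrMr.
Qed.

(** The Moebius bound is linear in [r] = Re w - 1/2; since [r >= eta], it is at most a multiple of
    [r ^+ 3]. The distance [delta] bounds the denominator [|c 0 - w|^2] from below. *)
Lemma mean_counting_far (delta eta : R) : 0 < delta -> 0 < eta ->
  exists A : R, forall w : C, 1 / 2 < complex.Re w -> delta <= cabs (w - c 0) ->
    eta <= complex.Re w - 1 / 2 ->
    (mean_counting Phi w * ((complex.Re w - 1 / 2) ^+ 3)^-1%:E < A%:E)%E.
Proof.
move=> delta0 eta0; have hc := Re_G0_limit G0.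
pose h := complex.Re (c 0) - 1 / 2; have h0 : 0 <= h by rewrite subr_ge0.
pose D := delta ^+ 2 * eta ^+ 2; have D0 : 0 < D by rewrite mulr_gt0 ?exprn_gt0.
exists (80 * pi * h / D + 1) => w hw wd we.
set r := complex.Re w - 1 / 2 in we *.
have r0 : 0 < r by rewrite subr_gt0.
have wc : w != c 0.
  by apply: contraTneq wd => ->; rewrite subrr cabs0 -ltNge.
apply: lt_of_mean_counting_le (moebius_mean_counting_le G0 hw wc) _ _; first by rewrite exprn_gt0.
have n0 : 0 < cabs (c 0 - w) ^+ 2 by rewrite exprn_gt0 // cabs_gt0 subr_eq0 eq_sym.
have nd : delta ^+ 2 <= cabs (c 0 - w) ^+ 2.
  by rewrite cabs_sub lerXn2r ?nnegrE ?cabs_ge0 ?(ltW delta0).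
have -> : (cabs (moebius w (c 0)) ^+ 2)^-1 - 1 = 4 * r * h / cabs (c 0 - w) ^+ 2.
  rewrite /moebius cabsM cabsV exprMn exprVn invfM invrK.
  have -> : cabs (c 0 + (w^* - 1)) ^+ 2 = cabs (c 0 - w) ^+ 2 + 4 * r * h.
    by rewrite !sqr_cabs /r /h; case: (c 0) => a b; case: (w) => p q /=; field.
  by move: (cabs _ ^+ 2) n0 => n n0; field; rewrite gt_eqF.
have r2 : eta ^+ 2 <= r ^+ 2 by rewrite lerXn2r ?nnegrE ?(ltW eta0) ?(ltW r0).
have pi0 := pi_gt0 R.
have h1 : 4 * r * h / cabs (c 0 - w) ^+ 2 <= 4 * h / D * r ^+ 3.
  rewrite ler_pdivrMr //.
  have -> : 4 * r * h = 4 * h / D * r * (delta ^+ 2 * eta ^+ 2).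
    by rewrite -/D; field; rewrite gt_eqF.
  have -> : 4 * h / D * r ^+ 3 * cabs (c 0 - w) ^+ 2 = 4 * h / D * r * (cabs (c 0 - w) ^+ 2 * r ^+ 2) by ring.
  apply: ler_wpM2l; last by apply: ler_pM => //; exact: sqr_ge0.
  by rewrite mulr_ge0 ?(ltW r0) // divr_ge0 ?(ltW D0) // mulr_ge0.
have h2 : pi * (20 * (4 * r * h / cabs (c 0 - w) ^+ 2)) <= pi * (20 * (4 * h / D * r ^+ 3)).
  by rewrite ler_pM2l // ler_pM2l ?ltr0n.
apply: (le_lt_trans h2).
rewrite [ltRHS]mulrDl mul1r.
have -> : pi * (20 * (4 * h / D * r ^+ 3)) = 80 * pi * h / D * r ^+ 3 by ring.
by rewrite ltrDl exprn_gt0.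
Qed.

(** The threshold on Re w - 1/2 gives [4 * (|K| + 1) <= kernel_sum], hence the smallness condition
    behind [|F(+oo)| >= 1 / 2]. The norm of [b] is kept in the final bound because compactness will
    make it small. *)
Lemma test_function (K : R) (w : C) :
  (forall a : nat -> C, inH2 a -> exists b : nat -> C,
     [/\ inH2 b, DPhi_rel Phi a b & H2norm2 b <= K * H2norm2 a]) ->
  1 / 2 < complex.Re w -> complex.Re w <= 1 ->
  complex.Re w - 1 / 2 < kernel_const R / (4 * (`|K| + 1)) ->
  exists N b, [/\ 0 < kernel_sum w N, kernel_const R <= kernel_sum w N * (complex.Re w - 1 / 2) ^+ 3,
    inH2 b /\ DPhi_rel Phi (kernel_coef w N) b, H2norm2 b <= `|K| + 1 &
    (mean_counting Phi w <=
      (80 * pi / kernel_const R * H2norm2 b * (complex.Re w - 1 / 2) ^+ 3)%:E)%E].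
Proof.
move=> HK hw w1 wK; set r := complex.Re w - 1 / 2 in wK *.
have r0 : 0 < r by rewrite subr_gt0.
have r1 : r <= 1 by rewrite /r; lra.
have cS := kernel_const_gt0 R.
have r30 : 0 < r ^+ 3 by rewrite exprn_gt0.
have K1 : 0 < `|K| + 1 by rewrite ltr_wpDl.
have [N HN] := kernel_sum_ge hw w1; rewrite -/r in HN.
have S0 : 0 < kernel_sum w N.
  by rewrite -(pmulr_lgt0 _ r30); exact: lt_le_trans HN.
have [a2 a1] := kernel_coef_norm S0.
have [b [b2 Hb bK]] := HK _ a2.
have b2K : H2norm2 b <= `|K| + 1.
  by move: bK; rewrite a1 mulr1; have := ler_norm K; lra.
have SK : 4 * (`|K| + 1) <= kernel_sum w N.
  rewrite -(ler_pM2r r30); apply: le_trans HN.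
  have : r ^+ 3 <= r by rewrite exprS ler_piMr ?(ltW r0) // exprn_ile1 // ltW.
  move=> r3r; apply: (@le_trans _ _ (4 * (`|K| + 1) * r)).
    by rewrite ler_pM2l // mulr_gt0.
  by rewrite mulrC -ler_pdivlMr ?mulr_gt0 // ltW.
exists N, b; split=> //.
have := kernel_mean_counting_le G0 hw S0 Hb b2.
have bS : 4 * H2norm2 b <= kernel_sum w N by lra.
move=> /(_ bS)/le_trans; apply; rewrite lee_fin.
have b0 : 0 <= H2norm2 b.
  by have := sumr_sqr_le_H2norm2 0 b2; rewrite big_ord0.
have -> : 80 * pi / kernel_const R * H2norm2 b * r ^+ 3 = 80 * pi * (H2norm2 b * (r ^+ 3 / kernel_const R)).
  by field; rewrite gt_eqF.
rewrite ler_wpM2l ?mulr_ge0 ?pi_ge0 // ler_wpM2l //.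
rewrite ler_pdivlMr // mulrC ler_pdivrMr // mulrC //.
Qed.

(** Since Re Phi(s) > 1/2, the series behind [kernel_coef_deriv_le] converges at u = Phi(s). With
    [coef_decay] this yields coefficientwise convergence of the images to 0. *)
Lemma kernel_image_decay (w : nat -> C) (N : nat -> nat) (b : nat -> nat -> C) :
  (forall n, [/\ 1 / 2 < complex.Re (w n), complex.Re (w n) - 1 / 2 < n.+1%:R^-1,
     0 < kernel_sum (w n) (N n),
     kernel_const R <= kernel_sum (w n) (N n) * (complex.Re (w n) - 1 / 2) ^+ 3 &
     DPhi_rel Phi (kernel_coef (w n) (N n)) (b n)]) ->
  forall (s : C) (d : R), 1 / 2 < complex.Re s -> 0 < d -> exists n0, forall n, (n0 <= n)%N ->
    exists2 z, csum_to (dterm (b n) s) z & cabs z <= d.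
Proof.
move=> H s d hs d0.
have hu : 1 < 1 / 2 + complex.Re (Phi s).
  have s0 : 0 < complex.Re s by lra.
  by have := G0.2 s s0; lra.
have [Z0 HZ0] := sum_ln_sqr_le hu.
pose Z := `|Z0| + 1.
have Z1 : 0 < Z by rewrite ltr_wpDl.
have HZ M : \sum_(k < M) ln k.+1%:R ^+ 2 * expR (- (1 / 2 + complex.Re (Phi s)) * ln k.+1%:R) <= Z.
  by apply: (le_trans (HZ0 M)); rewrite /Z; have := ler_norm Z0; lra.
have cS := kernel_const_gt0 R.
exists (Num.trunc (Z ^+ 2 / (d ^+ 2 * kernel_const R))) => n nn.
have [hw wn S0 HS Hb] := H n.
have [z [za zb]] := Hb s hs; exists z => //.
have -> : z = \sum_(k < N n) dterm_deriv (kernel_coef (w n) (N n)) (Phi s) k.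
  apply: csum_to_unique za _; apply: csum_to_finite => k /kernel_coef_support ak.
  by rewrite /dterm_deriv ak mul0r oppr0 mul0r.
apply: (le_trans (kernel_coef_deriv_le (N n) (ltW hw) HZ)).
have r0 : 0 < Num.sqrt (kernel_sum (w n) (N n)) by rewrite sqrtr_gt0.
rewrite ler_pdivrMl // mulrC -ler_pdivrMl //.
rewrite -(@ler_pXn2r _ 2) ?nnegrE ?sqrtr_ge0 //; last first.
  by rewrite mulr_ge0 ?invr_ge0 ?(ltW d0) ?(ltW Z1).
rewrite sqr_sqrtr ?(ltW S0) // mulrC exprMn exprVn.
set r := complex.Re (w n) - 1 / 2 in wn HS.
have rr0 : 0 < r by rewrite subr_gt0.
have n1 : 0 < n.+1%:R :> R by rewrite ltr0n.
have r1 : r <= n.+1%:R^-1 by exact: ltW.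
have rle1 : r <= 1 by apply: (le_trans r1); rewrite invf_le1 // ler1n.
have HS' : kernel_const R * n.+1%:R <= kernel_sum (w n) (N n).
  rewrite -ler_pdivlMr //; apply: (le_trans HS); rewrite ler_pM2l //.
  by apply: le_trans r1; rewrite exprS ler_piMr ?(ltW rr0) // exprn_ile1 // ltW.
apply: le_trans HS'.
have : Z ^+ 2 / (d ^+ 2 * kernel_const R) <= n.+1%:R.
  by apply: ltW; apply: lt_le_trans (truncnS_gt _) _; rewrite ler_nat.
rewrite ler_pdivrMr ?mulr_gt0 ?exprn_gt0 // ler_pdivrMr ?exprn_gt0 //.
by suff -> : n.+1%:R * (d ^+ 2 * kernel_const R) = kernel_const R * n.+1%:R * d ^+ 2 by []; ring.
Qed.

(** A Cauchy sequence in H^2 whose coefficients tend to 0 must tend to 0 in norm, against the lower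
    bound [E]. Finite sections of two terms are compared instead of passing to a limit. *)
Lemma H2_cauchy_decay (b : nat -> nat -> C) (phi : nat -> nat) (E : R) : 0 < E ->
  (forall n, inH2 (b n)) -> (forall n, E <= H2norm2 (b n)) ->
  (forall k (d : R), 0 < d -> exists n0, forall n, (n0 <= n)%N -> cabs (b n k) <= d) ->
  (forall k, (phi k < phi k.+1)%N) ->
  (forall e : R, 0 < e -> exists N, forall i j, (N <= i)%N -> (N <= j)%N ->
     H2norm2 (fun n => b (phi i) n - b (phi j) n) < e) -> False.
Proof.
move=> E0 b2 bE bd phiS cauchy.
have phi_ge j : (j <= phi j)%N.
  by elim: j => // j IH; exact: leq_ltn_trans IH (phiS j).
have [N HN] := cauchy _ (divr_gt0 E0 (ltr0n _ 2)).
have inH2B i j : inH2 (fun n => b i n - b j n).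
  apply: (@inH2_le _ _ (2 * H2norm2 (b i) + 2 * H2norm2 (b j))) => M.
  apply: (@le_trans _ _ (\sum_(k < M) (2 * cabs (b i k) ^+ 2 + 2 * cabs (b j k) ^+ 2))).
    apply: ler_sum => k _; have := sqr_cabsD_le (b i k) (- b j k) (@ltr01 R).
    by rewrite cabsN invr1; lra.
  by rewrite big_split /= -!mulr_sumr lerD // ler_pM2l // sumr_sqr_le_H2norm2.
(* Here 7/8 = 3/2 * 1/2 + 1/8: Young's inequality with parameter 1/2 for the Cauchy difference, plus
   the first [M] coefficients of a later term [b (phi j)]. The index [j] depends on [M], but [N]
   does not. *)
suff : H2norm2 (b (phi N)) <= 7 / 8 * E by have := bE (phi N); lra.
apply: H2norm2_le => // M.
pose d := Num.min 1 (E / (24 * M.+1%:R)).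
have M1 : 0 < 24 * M.+1%:R :> R by rewrite mulr_gt0 // ltr0n.
have d0 : 0 < d by rewrite lt_min ltr01 divr_gt0.
have d1 : d <= 1 by rewrite ge_min lexx.
have dM : 24 * M.+1%:R * d <= E by rewrite -ler_pdivlMl // mulrC ge_min lexx orbT.
clearbody d; have [n0 Hn0] := finite_eventually (fun k => bd k d d0) M.
pose j := maxn N n0.
have bj k : (k < M)%N -> cabs (b (phi j) k) <= d.
  by apply: Hn0; apply: leq_trans (phi_ge j); rewrite leq_maxr.
have := HN N j (leqnn N) (leq_maxl N n0).
have := sumr_sqr_le_H2norm2 M (inH2B (phi N) (phi j)).
set Sg := \sum_(k < M) _ => h1 h2.
apply: (@le_trans _ _ (\sum_(k < M) (3 / 2 * cabs (b (phi N) k - b (phi j) k) ^+ 2 + 3 * d))).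
  apply: ler_sum => k _.
  have t0 : 0 < 1 / 2 :> R by [].
  have := sqr_cabsD_le (b (phi N) k - b (phi j) k) (b (phi j) k) t0.
  rewrite subrK div1r invrK => h3.
  have : cabs (b (phi j) k) ^+ 2 <= d * 1.
    rewrite expr2; apply: ler_pM; rewrite ?cabs_ge0 ?bj //.
    by apply: le_trans d1; exact: bj.
  by move: h3; lra.
rewrite big_split /= -mulr_sumr -/Sg sumr_const card_ord -[3 * d *+ M]mulr_natr.
have : 3 * d * M%:R <= 3 * d * M.+1%:R by rewrite ler_wpM2l ?ler_nat // mulr_ge0 // ltW.
move: dM; move: (M.+1%:R) (M%:R) => m m' dM h3.
have : 3 * d * m' <= E / 8 by lra.
by lra.
Qed.

Lemma mean_counting_bounded : DPhi_bounded Phi -> forall delta : R, 0 < delta ->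
  exists A : R, forall w : C, 1 / 2 < complex.Re w -> delta <= cabs (w - c 0) ->
    (mean_counting Phi w * ((complex.Re w - 1 / 2) ^+ 3)^-1%:E < A%:E)%E.
Proof.
move=> [K HK] delta delta0; have cS := kernel_const_gt0 R.
have K1 : 0 < `|K| + 1 by rewrite ltr_wpDl.
pose eta := Num.min (1 / 2) (kernel_const R / (4 * (`|K| + 1))).
have eta0 : 0 < eta by rewrite lt_min divr_gt0 //= divr_gt0 // mulr_gt0.
have [A1 HA1] := mean_counting_far delta0 eta0.
pose A2 := 80 * pi / kernel_const R * (`|K| + 1) + 1.
exists (Num.max A1 A2) => w hw wd.
have [we|we] := lerP eta (complex.Re w - 1 / 2).
  by apply: lt_le_trans (HA1 w hw wd we) _; rewrite lee_fin le_max lexx.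
apply: (@lt_le_trans _ _ A2%:E); last by rewrite lee_fin le_max lexx orbT.
move: we; rewrite lt_min => /andP[we1 we2].
have w1 : complex.Re w <= 1 by lra.
have [N [b [_ _ _ bK /lt_of_mean_counting_le]]] := test_function HK hw w1 we2.
have r30 : 0 < (complex.Re w - 1 / 2) ^+ 3 by rewrite exprn_gt0 // subr_gt0.
apply => //; rewrite ltr_pM2r // /A2.
apply: (@le_lt_trans _ _ (80 * pi / kernel_const R * (`|K| + 1))); last by rewrite ltrDl.
by rewrite ler_wpM2l // divr_ge0 ?(ltW cS) // mulr_ge0 // pi_ge0.
Qed.

Lemma mean_counting_vanishing : DPhi_compact Phi -> forall e : R, 0 < e ->
  exists eta : R, 0 < eta /\
    forall w : C, 1 / 2 < complex.Re w -> complex.Re w < 1 / 2 + eta -> w != c 0 ->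
      (mean_counting Phi w * ((complex.Re w - 1 / 2) ^+ 3)^-1%:E < e%:E)%E.
Proof.
move=> [[K HK] cpt] e e0; have cS := kernel_const_gt0 R.
have K1 : 0 < `|K| + 1 by rewrite ltr_wpDl.
apply: contrapT => bad.
(* If [H2norm2 b] were below [E], the bound in [test_function] would put the ratio below [e]. So
   each counterexample [w] yields an image of squared norm at least [E]. *)
pose E := e * kernel_const R / (80 * pi).
have pi0 := pi_gt0 R.
have E0 : 0 < E by rewrite divr_gt0 // mulr_gt0.
have seq n : exists p : C * nat * (nat -> C), let: (w, N, b) := p in
    [/\ 1 / 2 < complex.Re w, complex.Re w - 1 / 2 < n.+1%:R^-1, 0 < kernel_sum w N,
     kernel_const R <= kernel_sum w N * (complex.Re w - 1 / 2) ^+ 3 &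
     [/\ DPhi_rel Phi (kernel_coef w N) b, inH2 b, H2norm2 b <= `|K| + 1 & E <= H2norm2 b]].
  pose eta := Num.min n.+1%:R^-1 (Num.min (1 / 2) (kernel_const R / (4 * (`|K| + 1)))).
  have eta0 : 0 < eta by rewrite !lt_min invr_gt0 ltr0n /= divr_gt0 //= divr_gt0 // mulr_gt0.
  have /existsNP[w /not_implyP[hw /not_implyP[we /not_implyP[wc wbad]]]] :
      ~ forall w : C, 1 / 2 < complex.Re w -> complex.Re w < 1 / 2 + eta -> w != c 0 ->
      (mean_counting Phi w * ((complex.Re w - 1 / 2) ^+ 3)^-1%:E < e%:E)%E.
    by move=> h; apply: bad; exists eta.
  move: we; rewrite -ltrBlDl !lt_min => /andP[we1 /andP[we2 we3]].
  have w1 : complex.Re w <= 1 by lra.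
  have [N [b [S0 HS [b2 Hb] bK mb]]] := test_function HK hw w1 we3.
  exists (w, N, b); split=> //; split=> //.
  rewrite leNgt; apply/negP => bE; apply: wbad.
  have r30 : 0 < (complex.Re w - 1 / 2) ^+ 3 by rewrite exprn_gt0 // subr_gt0.
  apply: lt_of_mean_counting_le mb _ _ => //; rewrite ltr_pM2r //.
  rewrite mulrAC ltr_pdivrMr // mulrC -ltr_pdivlMr ?mulr_gt0 //.
have [f Hf] := choice seq.
pose w n := (f n).1.1; pose N n := (f n).1.2; pose b n := (f n).2.
have Hw n : [/\ 1 / 2 < complex.Re (w n), complex.Re (w n) - 1 / 2 < n.+1%:R^-1,
     0 < kernel_sum (w n) (N n),
     kernel_const R <= kernel_sum (w n) (N n) * (complex.Re (w n) - 1 / 2) ^+ 3 &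
     [/\ DPhi_rel Phi (kernel_coef (w n) (N n)) (b n), inH2 (b n),
       H2norm2 (b n) <= `|K| + 1 & E <= H2norm2 (b n)]].
  by have := Hf n; rewrite /w /N /b; case: (f n) => -[].
have [|||phi [phiS cauchy]] := cpt (fun n => kernel_coef (w n) (N n)) b.
- by move=> n; have [_ _ S0 _ _] := Hw n; have [] := kernel_coef_norm S0.
- by move=> n; have [_ _ S0 _ _] := Hw n; have [_ ->] := kernel_coef_norm S0.
- by move=> n; have [_ _ _ _ []] := Hw n.
apply: (H2_cauchy_decay E0 _ _ _ phiS cauchy).
- by move=> n; have [_ _ _ _ []] := Hw n.
- by move=> n; have [_ _ _ _ []] := Hw n.
apply: (@coef_decay R b (`|K| + 1)).
  move=> n M; have [_ _ _ _ [_ b2 bK _]] := Hw n.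
  exact: le_trans (sumr_sqr_le_H2norm2 M b2) bK.
apply: (@kernel_image_decay w N b) => n.
by have [h1 h2 h3 h4 []] := Hw n.
Qed.

End Main.

End MeanCountingFunction.

Theorem theorem2p3 (R : realType) (c : nat -> R[i]) (Phi : R[i] -> R[i])
  (hG0 : in_G0 c Phi) (hbdd : DPhi_bounded Phi) :
  (forall delta : R, 0 < delta -> exists C : R,
     forall w : R[i], 1 / 2 < complex.Re w -> delta <= cabs (w - c 0%N) ->
       (mean_counting Phi w * ((complex.Re w - 1 / 2) ^+ 3)^-1%:E < C%:E)%E)
  /\
  (DPhi_compact Phi ->
     forall e : R, 0 < e -> exists eta : R, 0 < eta /\
       forall w : R[i], 1 / 2 < complex.Re w -> complex.Re w < 1 / 2 + eta -> w != c 0%N ->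
         (mean_counting Phi w * ((complex.Re w - 1 / 2) ^+ 3)^-1%:E < e%:E)%E).
Proof.
split; first exact: (mean_counting_bounded hG0 hbdd).
exact: mean_counting_vanishing hG0.
Qed.
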